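(* Let $n\ge 3$, let $\mathbb{K}$ be a field, and let $\mathbb{G}$ be a strongly connected digraph on $n$ vertices (equivalently, let its Laplacian $L$ be an $n\times n$ ICB matrix). Let $\mathcal{L}\subset\mathbb{Z}^n$ be the lattice spanned by the columns of $L$, $I(\mathcal{L})\subset\mathbb{K}[x]=\mathbb{K}[x_1,\dots,x_n]$ its lattice ideal, and $\mathcal{C}_{\mathbb{G}}=(\mathcal{C}_k,\partial_k)$ the associated Cyc complex. Then $$0\leftarrow \mathbb{K}[x]/I(\mathcal{L})\leftarrow\mathcal{C}_0=\mathbb{K}[x]\xleftarrow{\ \partial_1\ }\mathcal{C}_1=\mathbb{K}[x]^{r_1}\xleftarrow{\ \partial_2\ }\cdots\xleftarrow{\ \partial_{n-1}\ }\mathcal{C}_{n-1}=\mathbb{K}[x]^{r_{n-1}}\leftarrow 0$$ is a minimal free resolution of $\mathbb{K}[x]/I(\mathcal{L})$ if and only if $\mathbb{G}$ is strongly complete.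
   Context: **Digraphs and matrices.** A digraph $\mathbb{G}$ is a finite directed graph with vertices $v_1,\dots,v_n$, whose arcs are ordered pairs $(v_i,v_j)$ with $i\ne j$, each arc carrying a positive integer weight, and with no sources and no sinks (every vertex has at least one incoming and at least one outgoing arc). For $i\neq j$ let $a_{i,j}$ be the weight of the arc $(v_i,v_j)$, and $a_{i,j}=0$ if there is no such arc; put $a_{i,i}=\sum_{j\ne i}a_{i,j}$. The Laplacian $L$ is the $n\times n$ matrix with diagonal entries $a_{i,i}$ and off-diagonal entries $-a_{i,j}$. The Laplacians of digraphs are exactly the CB matrices: integer matrices with diagonal entries $a_{i,i}>0$, off-diagonal entries $-a_{i,j}$ with $a_{i,j}\ge0$, $a_{i,i}=\sum_{j\neq i}a_{i,j}$, and at least one nonzero off-diagonal entry in each column. $\mathbb{G}$ is strongly connected if any two distinct vertices can be joined by a directed path (in each direction); equivalently $L$ is irreducible (there is no partition of $[n]=\{1,\dots,n\}$ into non-empty sets $I,J$ with $a_{i,j}=0$ for all $i\in I$, $j\in J$). An irreducible CB matrix is called an ICB matrix. $\mathbb{G}$ is strongly complete if $(v_i,v_j)$ is an arc for all $i\neq j$, i.e. $a_{i,j}>0$ for all $i,j$. **Lattice ideal.** $I(\mathcal{L})=(x^{l^+}-x^{l^-}\mid l\in\mathcal{L})$, where $l=l^+-l^-$ with $l^+=\max(l,0)$, $l^-=-\min(l,0)$ componentwise. **Cyc complex.** For disjoint $I,J\subseteq[n]$ put $x^{I\to J}=\prod_{i\in I}x_i^{\sum_{j\in J}a_{i,j}}$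 (equal to $1$ if $I$ or $J$ is empty). $\mathrm{Cyc}_{n,k}$ is the set of cyclically ordered partitions of $[n]$ into $k$ non-empty blocks, each represented uniquely as $(I_1,\dots,I_k)$ with $n\in I_k$. For $0\le k\le n-1$, $\mathcal{C}_k$ is the free $\mathbb{K}[x]$-module with basis $\mathrm{Cyc}_{n,k+1}$, of rank $r_k=|\mathrm{Cyc}_{n,k+1}|$; $\mathcal{C}_0=\mathbb{K}[x]$ with $([n])$ identified with $1$. The map $\partial_k:\mathcal{C}_k\to\mathcal{C}_{k-1}$ ($1\le k\le n-1$) is the $\mathbb{K}[x]$-linear map with $$\partial_k(I_1,\dots,I_{k+1})=\sum_{s=1}^{k}(-1)^{s-1}x^{I_s\to I_{s+1}}(I_1,\dots,I_s\cup I_{s+1},\dots,I_{k+1})-x^{I_{k+1}\to I_1}(I_2,\dots,I_k,I_1\cup I_{k+1}).$$ **Minimality.** With $\mathfrak{m}=(x_1,\dots,x_n)$, a free resolution is minimal when $\partial_k(\mathcal{C}_k)\subseteq\mathfrak{m}\,\mathcal{C}_{k-1}$ for all $1\le k\le n-1$. The map $\mathcal{C}_0\to\mathbb{K}[x]/I(\mathcal{L})$ is the natural projection. *)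

(* Defs.v *)
From HB Require Import structures.
From mathcomp Require Import all_boot all_order all_algebra ring_quotient.
From mathcomp Require Import boolp.
From mathcomp.multinomials Require Import mpoly.

Set Implicit Arguments.
Unset Strict Implicit.
Unset Printing Implicit Defensive.

Import Order.TTheory GRing.Theory Num.Theory.
Local Open Scope ring_scope.

(* The [R]-submodule of [V] spanned by [S].  With [V := R^o] it is the ideal  *)
(* generated by [S], with [R := int] the subgroup generated by [S].           *)
Definition in_span (R : pzRingType) (V : lmodType R) (S : V -> Prop) (v : V) :
    Prop :=
  exists (m : nat) (r : 'I_m -> R) (s : 'I_m -> V),
    (forall i, S (s i)) /\ v = \sum_(i < m) r i *: s i.

Record digraph (n : nat) := Digraph {
  weight :> 'I_n -> 'I_n -> nat;  (* 0 when there is no arc *)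
  weight_loopless : forall i, weight i i = 0%N;
  weight_no_sink : forall i, exists j, (0 < weight i j)%N;
  weight_no_source : forall j, exists i, (0 < weight i j)%N
}.

Definition arc n (G : digraph n) : rel 'I_n := fun i j => (0 < G i j)%N.

Definition strongly_connected n (G : digraph n) : Prop :=
  forall i j, connect (arc G) i j.

Definition strongly_complete n (G : digraph n) : Prop :=
  forall i j, i != j -> arc G i j.

Definition laplacian n (G : digraph n) : 'M[int]_n :=
  \matrix_(i, j) if i == j then (\sum_(k | k != i) G i k)%N%:Z
                 else - (G i j)%:Z.

Definition lattice n (L : 'M[int]_n) : 'cV[int]_n -> Prop :=
  in_span (fun v => exists j, v = col j L).

Section LatticeIdeal.

Variables (K : fieldType) (n : nat).

Definition mnm_pos (l : 'cV[int]_n) : 'X_{1..n} :=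
  [multinom `|(Num.max (l i 0) 0)%R|%N | i < n].

Definition mnm_neg (l : 'cV[int]_n) : 'X_{1..n} :=
  [multinom `|(- Num.min (l i 0) 0)%R|%N | i < n].

Definition in_lattice_ideal (L : 'cV[int]_n -> Prop) : {mpoly K[n]} -> Prop :=
  in_span (V := {mpoly K[n]}^o)
    (fun f => exists2 l, L l & f = 'X_[mnm_pos l] - 'X_[mnm_neg l]).

Definition lattice_ideal (L : 'cV[int]_n -> Prop) : {pred {mpoly K[n]}} :=
  fun p => `[< in_lattice_ideal L p >].

Lemma lattice_ideal_closed L : idealr_closed (lattice_ideal L).
Proof.
split.
- apply/asboolP; exists 0%N, (fun _ => 0), (fun _ => 0).
  by split=> [[]//|]; rewrite big_ord0.
- apply/negP => /asboolP [m [r [s [Ss /(congr1 (meval (fun _ => 1)))]]]].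
  rewrite meval1 raddf_sum big1 => [/eqP|i _]; first by rewrite oner_eq0.
  case: (Ss i) => l _ -> /=; rewrite /GRing.scale /= mevalM mevalB !mevalX.
  by rewrite !big1 ?subrr ?mulr0 // => j _; rewrite expr1n.
- move=> a u v /asboolP [m1 [r1 [s1 [S1 ->]]]] /asboolP [m2 [r2 [s2 [S2 ->]]]].
  apply/asboolP; exists (m1 + m2)%N,
    (fun i => match split i with inl j => a * r1 j | inr j => r2 j end),
    (fun i => match split i with inl j => s1 j | inr j => s2 j end).
  split=> [i|]; first by case: (split i).
  rewrite big_split_ord /= mulr_sumr; congr (_ + _); apply: eq_bigr => i _.
    by rewrite (unsplitK (inl i)) -scalerA.
  by rewrite (unsplitK (inr i)).
Qed.

HB.instance Definition _ L :=
  isIdealr.Build {mpoly K[n]} (lattice_ideal L) (lattice_ideal_closed L).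

Definition lattice_ring (L : 'cV[int]_n -> Prop) : Type :=
  {ideal_quot (lattice_ideal L)}.

HB.instance Definition _ L := GRing.ComNzRing.on (lattice_ring L).

Definition lattice_proj (L : 'cV[int]_n -> Prop) :
    {mpoly K[n]} -> lattice_ring L :=
  \pi_({ideal_quot (lattice_ideal L)})%qT.

Section QuotientModule.
Variable L : 'cV[int]_n -> Prop.

Definition lattice_scale (a : {mpoly K[n]}) (v : lattice_ring L) :
  lattice_ring L := lattice_proj L a * v.

Lemma lattice_projD : {morph lattice_proj L : p q / p + q}.
Proof. exact: raddfD. Qed.

Lemma lattice_projM : {morph lattice_proj L : p q / p * q}.
Proof. exact: rmorphM. Qed.

Lemma lattice_scaleA a b v :
  lattice_scale a (lattice_scale b v) = lattice_scale (a * b) v.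
Proof. by rewrite /lattice_scale lattice_projM mulrA. Qed.

Lemma lattice_scale1 : left_id 1 lattice_scale.
Proof.
move=> v; rewrite /lattice_scale -[RHS]mul1r; congr (_ * _); exact: rmorph1.
Qed.

Lemma lattice_scaleDr : right_distributive lattice_scale +%R.
Proof. by move=> a u v; rewrite /lattice_scale mulrDr. Qed.

Lemma lattice_scaleDl v : {morph lattice_scale^~ v : a b / a + b}.
Proof. by move=> a b; rewrite /lattice_scale lattice_projD mulrDl. Qed.

HB.instance Definition _ := GRing.Zmodule_isLmodule.Build {mpoly K[n]}
  (lattice_ring L) lattice_scaleA lattice_scale1
  lattice_scaleDr lattice_scaleDl.

End QuotientModule.

End LatticeIdeal.

Section CyclicPartition.

Variable n : nat.
Implicit Types (t : seq {set 'I_n}) (A B C : {set 'I_n}).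

(* An ordered partition of the vertices whose last block contains the last    *)
(* vertex; every cyclically ordered partition is represented by exactly one.  *)
Definition is_cyc t : bool :=
  [&& set0 \notin t, pairwise (fun A B => [disjoint A & B]) t,
      \bigcup_(A <- t) A == [set: 'I_n]
    & [exists i : 'I_n, (i.+1 == n) && (i \in last set0 t)]].

Record cyc (k : nat) := Cyc {
  blocks :> k.-tuple {set 'I_n};
  blocksP : is_cyc blocks
}.

HB.instance Definition _ k := [isSub for @blocks k].
HB.instance Definition _ k := [Finite of cyc k by <:].

Definition block t (s : nat) : {set 'I_n} := nth set0 t s.

(* Blocks are numbered from 0: this merges blocks [s] and [s.+1]. *)
Definition merge_seq (s : nat) t : seq {set 'I_n} :=
  take s t ++ (block t s :|: block t s.+1) :: drop s.+2 t.

(* (I_1, ..., I_{k+1}) |-> (I_2, ..., I_k, I_1 u I_{k+1}) *)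
Definition wrap_seq t : seq {set 'I_n} :=
  rcons (behead (take (size t).-1 t)) (block t 0 :|: block t (size t).-1).

Lemma disjointsU A B C :
  [disjoint A & C] -> [disjoint B & C] -> [disjoint A :|: B & C].
Proof. by rewrite -!setI_eq0 setIUl => /eqP -> /eqP ->; rewrite setU0. Qed.

Lemma is_cyc_merge s t :
  (s.+1 < size t)%N -> is_cyc t -> is_cyc (merge_seq s t).
Proof.
move=> lt_st; have lt_s := ltnW lt_st; rewrite /merge_seq /block.
rewrite -{1}(cat_take_drop s t) (drop_nth set0) // (drop_nth set0 lt_st).
move: (take s t) (nth _ _ s) (nth _ _ s.+1) (drop s.+2 t) => t1 A B t2.
rewrite /is_cyc !mem_cat !inE !negb_or !pairwise_cat /= !big_cat !big_cons /=.
rewrite !last_cat /= !allrel_consr.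
case/and4P=> /and4P [-> nA nB ->] /and3P [/and3P [dA dB ->]].
move=> -> /= /and3P [/andP [dAB dA2] dB2 ->] cov last_t.
apply/and4P; split.
- rewrite andbT /=; apply: contra nA; rewrite eq_sym setU_eq0.
  by case/andP=> /eqP ->.
- rewrite !andbT; apply/andP; split.
    apply/allP=> C Ct /=; rewrite disjoint_sym disjointsU //.
      by rewrite disjoint_sym (allP dA).
    by rewrite disjoint_sym (allP dB).
  by apply/allP=> C Ct /=; rewrite disjointsU ?(allP dA2) ?(allP dB2).
- by rewrite -setUA.
- case/existsP: last_t => i /andP [ni it]; apply/existsP; exists i.
  rewrite ni /=; case: t2 {dA2 dB2 cov} it => //= it; by rewrite inE it orbT.
Qed.

Lemma is_cyc_wrap t : (1 < size t)%N -> is_cyc t -> is_cyc (wrap_seq t).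
Proof.
case: t => // A t; case: (lastP t) => // {}t B _.
rewrite /wrap_seq /block /= size_rcons /= nth_rcons ltnn eqxx.
rewrite -cats1 take_size_cat // cats1.
rewrite /is_cyc !inE !mem_rcons !inE !negb_or -!cats1 /= !pairwise_cat /=.
rewrite !all_cat /= !allrel1r !last_cat /= !big_cons !big_cat /= !big_seq1.
case/and4P=> /and3P [nA nB ->] /and3P [/and3P [dAt dAB _]].
move=> dtB /andP [-> _] cov /existsP [i /andP [ni iB]].
apply/and4P; split.
- rewrite andbT; apply: contra nA; rewrite eq_sym setU_eq0.
  by case/andP=> /eqP ->.
- rewrite !andbT; apply/allP=> C Ct /=; rewrite disjoint_sym disjointsU //.
    exact: (allP dAt).
  by rewrite disjoint_sym (allP dtB).
- by rewrite setUCA.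
- by apply/existsP; exists i; rewrite ni inE iB orbT.
Qed.

Lemma size_merge s t : (s.+1 < size t)%N -> size (merge_seq s t) = (size t).-1.
Proof.
move=> lt_st; rewrite size_cat /= size_takel ?size_drop; last exact/ltnW/ltnW.
case: (size t) lt_st => [|[|m]] //; rewrite !ltnS !subSS => le_sm.
by rewrite addnS subnKC.
Qed.

Lemma size_wrap t : (1 < size t)%N -> size (wrap_seq t) = (size t).-1.
Proof.
move=> lt1t; rewrite size_rcons size_behead size_takel ?leq_pred //.
by case: t lt1t => [|A [|B t]].
Qed.

Section Merge.
Variables (k : nat) (t : cyc k.+2).

Lemma merge_subproof (s : 'I_k.+1) : (s.+1 < size t)%N.
Proof. by rewrite size_tuple ltnS ltn_ord. Qed.

Lemma size_mergeP (s : 'I_k.+1) : size (merge_seq s t) == k.+1.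
Proof. by rewrite size_merge ?merge_subproof ?size_tuple. Qed.

Lemma size_wrapP : size (wrap_seq t) == k.+1.
Proof. by rewrite size_wrap size_tuple. Qed.

Lemma wrap_subproof : (1 < size t)%N. Proof. by rewrite size_tuple. Qed.

Definition cyc_merge (s : 'I_k.+1) : cyc k.+1 :=
  @Cyc k.+1 (Tuple (size_mergeP s))
    (is_cyc_merge (merge_subproof s) (blocksP t)).

Definition cyc_wrap : cyc k.+1 :=
  @Cyc k.+1 (Tuple size_wrapP) (is_cyc_wrap wrap_subproof (blocksP t)).

End Merge.

Lemma blocks_cyc1 (t : cyc 1) : blocks t = [:: [set: 'I_n]] :> seq _.
Proof.
case: t => -[[|A []] //= _] /and4P [_ _ + _].
by rewrite big_seq1 => /eqP ->.
Qed.

End CyclicPartition.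

Section CycComplex.

Variables (K : fieldType) (n : nat) (G : digraph n).

(* The degree [k] module: blocks are counted from 1, degrees from 0. *)
Definition cyc_module (k : nat) : lmodType {mpoly K[n]} :=
  {ffun cyc n k.+1 -> {mpoly K[n]}^o}.

Definition cyc_basis k (t : cyc n k.+1) : cyc_module k :=
  [ffun u => (u == t)%:R].

(* Meant for disjoint [I] and [J], so that loops do not matter. *)
Definition xarrow (I J : {set 'I_n}) : {mpoly K[n]} :=
  \prod_(i in I) 'X_i ^+ (\sum_(j in J) G i j)%N.

Definition cyc_boundary k (t : cyc n k.+2) : cyc_module k :=
  \sum_(s < k.+1)
     ((-1) ^+ s * xarrow (block t s) (block t s.+1))
       *: cyc_basis (cyc_merge t s)
  - xarrow (block t k.+1) (block t 0) *: cyc_basis (cyc_wrap t).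

(* This is the differential from degree [k.+1] to degree [k]. *)
Definition cyc_diff k (c : cyc_module k.+1) : cyc_module k :=
  \sum_(t : cyc n k.+2) (c t : {mpoly K[n]}) *: cyc_boundary t.

Lemma cyc_diff_is_linear k : linear (@cyc_diff k).
Proof.
move=> a u v; rewrite /cyc_diff scaler_sumr -big_split.
apply: eq_bigr => t _ /=.
by rewrite !ffunE scalerDl -scalerA.
Qed.

HB.instance Definition _ k := GRing.isLinear.Build {mpoly K[n]}
  (cyc_module k.+1) (cyc_module k) *:%R (@cyc_diff k) (@cyc_diff_is_linear k).

(* By [blocks_cyc1], [cyc n 1] has the only element ([n]) (when [n] > 0), so  *)
(* the sum is the coefficient at ([n]).                                       *)
Definition cyc_module0 (c : cyc_module 0) : {mpoly K[n]} :=
  \sum_(t : cyc n 1) c t.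

Definition cyc_aug (c : cyc_module 0) :
    lattice_ring K (lattice (laplacian G)) :=
  lattice_proj (lattice (laplacian G)) (cyc_module0 c).

Lemma cyc_aug_is_linear : linear cyc_aug.
Proof.
move=> a u v; rewrite /cyc_aug.
have -> : cyc_module0 (a *: u + v) = a * cyc_module0 u + cyc_module0 v.
  rewrite /cyc_module0 mulr_sumr -big_split; apply: eq_bigr => t _.
  by rewrite !ffunE.
by rewrite lattice_projD lattice_projM.
Qed.

HB.instance Definition _ := GRing.isLinear.Build {mpoly K[n]}
  (cyc_module 0) (lattice_ring K (lattice (laplacian G))) *:%R cyc_aug
  cyc_aug_is_linear.

Definition irrelevant_ideal : {mpoly K[n]} -> Prop :=
  in_span (V := {mpoly K[n]}^o) (fun p => exists i, p = 'X_i).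

End CycComplex.

Section FreeResolution.

Variables (R : comNzRingType) (M : lmodType R) (B : nat -> finType).

Notation F k := {ffun B k -> R^o}.

Definition exact_at (U V W : zmodType) (f : U -> V) (g : V -> W) : Prop :=
  forall v, g v = 0 <-> exists u, f u = v.

(* 0 <- M <- F 0 <- F 1 <- ... <- F N <- 0 is exact, where [d k] is the map   *)
(* F k <- F k.+1; only used for [N] > 0.                                      *)
Definition free_resolution (N : nat) (d : forall k, {linear F k.+1 -> F k})
    (eps : {linear F 0 -> M}) : Prop :=
  [/\ forall y, exists x, eps x = y,
      exact_at (d 0) eps,
      forall k, (k.+1 < N)%N -> exact_at (d k.+1) (d k)
    & forall k, k.+1 = N -> injective (d k)].

Definition in_ideal_smul (m : R -> Prop) (V : lmodType R) : V -> Prop :=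
  in_span (fun v => exists a u, m a /\ v = a *: u).

Definition minimal (m : R -> Prop) (N : nat)
    (d : forall k, {linear F k.+1 -> F k}) : Prop :=
  forall k, (k < N)%N -> forall c, in_ideal_smul m (d k c).

End FreeResolution.

(* Main.v *)
Require Import Defs.
From HB Require Import structures.
From mathcomp Require Import all_boot all_order all_algebra ring_quotient.
From mathcomp Require Import boolp zify ring.
From mathcomp.multinomials Require Import ssrcomplements mpoly.

Set Implicit Arguments.
Unset Strict Implicit.
Unset Printing Implicit Defensive.

Import Order.TTheory GRing.Theory Num.Theory.
Local Open Scope ring_scope.

(* Exactness holds for every strongly connected digraph.  Think of a monomial *)
(* x^m as a chip configuration; firing a set A of vertices divides it by      *)
(* x^{A -> ~A} and multiplies it by x^{~A -> A}, which moves m by an element  *)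
(* of the lattice.  A K-basis element x^a (I_1, ..., I_{k+1}) of the complex  *)
(* is a simplex whose vertices are the configurations obtained from a bottom  *)
(* configuration m by firing I_1, then I_2, ..., then I_k, and the            *)
(* differential is the simplicial one: removing the bottom vertex is the      *)
(* wrapping face, removing the others are the merging faces.                  *)
(*   Legal sets (not containing the last vertex) are closed under union, so m *)
(* has a largest one, A(m).  Joining a simplex with bottom m with the vertex  *)
(* obtained by firing A(m) gives an operator h such that dh + hd - id maps a  *)
(* simplex with bottom m to simplices with bottoms obtained by firing from m. *)
(* The inverse of the reduced Laplacian is nonnegative by the maximum         *)
(* principle, which yields weights strictly decreased by each legal firing;   *)
(* hence iterating id - dh kills every cycle.  In degree 0 the same process   *)
(* leads to configurations with A(m) empty, unique in each lattice class.     *)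
(*   Minimality says that no coefficient of the differential has a constant   *)
(* term; for n >= 3 the coefficient x_i^{a_ij} shows up in the boundary of    *)
(* the cyclic partition into {i}, {j} and the rest.                           *)

(** * Faces of cyclic partitions *)

(** In the basis of cells the monomial coefficients of the differential disappear ([diff_cell]), so
    the complex behaves like the simplicial chain complex of chains of firings, and [face_face]
    makes it square to zero. Joining with the vertex reached by the largest legal firing [amax]
    would contract it as a cone, except that removing the bottom vertex changes [amax];
    [htpy_cell_low] shows that this error only involves bottoms reached by a further firing. Strong
    connectivity enters through [lap_min_principle], which yields weights that drop under such
    firings ([exists_fire_decreasing]), and [cycle_boundary] follows by descent on the weight. In
    degree zero, [reduceP] and [reduced_unique] show that the binomials of the lattice are
    boundaries, whence [aug_exact].

    Minimality is read off constant terms. If all arcs are present, each coefficient is an arrow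
    between disjoint non-empty blocks, hence in the irrelevant ideal ([irrelevant_xarrow]). If an
    arc is missing, [minimal_coef0] isolates its coefficient, which is then 1, in the boundary of a
    partition into three blocks ([minimal_complete]). *)

Local Notation pairwise_disjoint t :=
  (pairwise (fun A B : {set _} => [disjoint A & B]) t).

Section CyclicFaces.

Variable n : nat.
Implicit Types (A B : {set 'I_n}) (t : seq {set 'I_n}).

Lemma disjoint_bigcup A t :
  [disjoint A & \bigcup_(B <- t) B] = all (fun B => [disjoint A & B]) t.
Proof.
elim: t => [|B t IH] /=; first by rewrite big_nil -setI_eq0 setI0 eqxx.
rewrite big_cons -IH -!setI_eq0 setIUr setU_eq0 //.
Qed.

Lemma setU_compl A B : A :|: B = setT -> [disjoint A & B] -> B = ~: A.
Proof.
move=> /setP AB /pred0P dAB; apply/setP=> i; have := AB i; have := dAB i.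
by rewrite /= !inE; case: (i \in A).
Qed.

Lemma merge_seq_cons s A t : merge_seq s.+1 (A :: t) = A :: merge_seq s t.
Proof. by []. Qed.

Lemma wrap_seq_rcons A t B : wrap_seq (A :: rcons t B) = rcons t (A :|: B).
Proof.
rewrite /wrap_seq /block /= size_rcons /= nth_rcons ltnn eqxx.
by rewrite -[in take _ _]cats1 take_size_cat.
Qed.

Lemma bigcup_rcons t B : \bigcup_(A <- rcons t B) A = \bigcup_(A <- t) A :|: B.
Proof. by rewrite -cats1 big_cat big_seq1. Qed.

Lemma bigcup_merge s t : (s.+1 < size t)%N ->
  \bigcup_(A <- merge_seq s t) A = \bigcup_(A <- t) A.
Proof.
elim: s t => [|s IH] [|A [|B t]] //= lt_st.
  by rewrite /merge_seq /block /= drop0 !big_cons setUA.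
by rewrite merge_seq_cons !(big_cons _ _ A) IH.
Qed.

Lemma last_merge s t : (s.+2 < size t)%N ->
  last set0 (merge_seq s t) = last set0 t.
Proof.
move=> lt_st; rewrite /merge_seq last_cat /=.
rewrite -[in RHS](cat_take_drop s.+2 t) last_cat.
by case: (drop s.+2 t) (size_drop s.+2 t) => //=; lia.
Qed.

(** With [wrap_merge] and [wrap_wrap], these are the simplicial identities for deleting two vertices
    of a chain: both above the bottom, the bottom and one above the next, and the two lowest. *)
Lemma merge_merge r s t : (r < s)%N -> (s.+1 < size t)%N ->
  merge_seq r (merge_seq s t) = merge_seq s.-1 (merge_seq r t).
Proof.
elim: r s t => [|r IH] [|s] [|A [|B t]] // lt_rs lt_st.
  rewrite merge_seq_cons /=.
  case: s t lt_rs lt_st => [|s] [|C t] // _ _; last first.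
    by rewrite /merge_seq /block /= !drop0.
  by rewrite /merge_seq /block /= !drop0 setUA.
case: s lt_rs lt_st => [|s] // lt_rs lt_st.
rewrite !(merge_seq_cons _ A) IH //=.
Qed.

Lemma merge_rcons s t A : (s.+1 < size t)%N ->
  merge_seq s (rcons t A) = rcons (merge_seq s t) A.
Proof.
move=> lt_s; rewrite /merge_seq /block !nth_rcons lt_s (ltnW lt_s).
by rewrite !drop_rcons // -cats1 takel_cat ?rcons_cat // ltnW // ltnW.
Qed.

Lemma merge_last t A B :
  merge_seq (size t) (rcons (rcons t A) B) = rcons t (A :|: B).
Proof.
rewrite /merge_seq /block !nth_rcons size_rcons ltnn eqxx leqnn ltnn eqxx.
by rewrite drop_oversize ?size_rcons // -!cats1 -catA take_size_cat.
Qed.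

Lemma wrap_merge s t : (s.+2 < size t)%N ->
  wrap_seq (merge_seq s.+1 t) = merge_seq s (wrap_seq t).
Proof.
case: t => // A t; case: (lastP t) => // {}t B.
rewrite /= size_rcons !ltnS => lt_st.
rewrite merge_seq_cons wrap_seq_rcons.
have: (s.+1 < size t)%N || (s.+1 == size t) by lia.
case/orP=> [lt_s | /eqP]; first by rewrite !merge_rcons // wrap_seq_rcons.
case: (lastP t) lt_st => // {}t C _; rewrite size_rcons => -[->].
by rewrite !merge_last wrap_seq_rcons setUCA.
Qed.

Lemma wrap_wrap t : (2 < size t)%N ->
  wrap_seq (merge_seq 0 t) = wrap_seq (wrap_seq t).
Proof.
case: t => [|A [|B t]] //; case: (lastP t) => // {}t C _.
rewrite {1}/merge_seq /block /= drop0 wrap_seq_rcons.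
by rewrite -rcons_cons !wrap_seq_rcons setUCA setUA.
Qed.

Lemma block0_merge s t : block (merge_seq s.+1 t) 0 = block t 0.
Proof. by case: t => //; rewrite /merge_seq /block /= setU0. Qed.

Lemma block0_wrap t : (2 < size t)%N -> block (wrap_seq t) 0 = block t 1.
Proof.
case: t => [|A [|B t]] //; case: (lastP t) => // {}t C _.
by rewrite -rcons_cons wrap_seq_rcons.
Qed.

Lemma is_cyc_disjoint t : is_cyc t -> pairwise_disjoint t.
Proof. by case/and4P. Qed.

Lemma is_cyc_cover t : is_cyc t -> \bigcup_(A <- t) A = setT.
Proof. by case/and4P=> _ _ /eqP. Qed.

Lemma block_neq0 t s : is_cyc t -> (s < size t)%N -> block t s != set0.
Proof.
case/and4P=> t0 _ _ _ lt_s; apply: contra t0 => /eqP <-.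
exact: mem_nth.
Qed.

End CyclicFaces.

(** * Exponents of arrows, labels and chip firing *)

Section Exponents.

Variables (n : nat) (G : digraph n).
Implicit Types (A B I J : {set 'I_n}) (t : seq {set 'I_n}) (m : 'X_{1..n}).

Definition arr I J : 'X_{1..n} :=
  [multinom ((i \in I) * \sum_(j in J) G i j)%N | i < n].

Lemma xarrowE (K : fieldType) I J : xarrow K G I J = 'X_[arr I J].
Proof.
rewrite mpolyXE_id /xarrow big_mkcond; apply: eq_bigr => i _.
by rewrite mnmE; case: (i \in I); rewrite ?mul1n // mul0n expr0.
Qed.

Lemma arrUl A B J : [disjoint A & B] -> arr (A :|: B) J = (arr A J + arr B J)%MM.
Proof.
move=> dAB; apply/mnmP=> i; rewrite mnmDE !mnmE -mulnDl inE.
by case: (boolP (i \in A)) => // /(disjointFr dAB) ->.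
Qed.

Lemma arrUr I A B : [disjoint A & B] -> arr I (A :|: B) = (arr I A + arr I B)%MM.
Proof.
move=> dAB; apply/mnmP=> i; rewrite mnmDE !mnmE -mulnDr; congr (_ * _)%N.
by rewrite -bigU //; apply: eq_bigl => j; rewrite !inE.
Qed.

(* The least common multiple of the monomials at the vertices of the simplex  *)
(* with bottom vertex 1: vertex s is obtained by firing the first s blocks.   *)
Fixpoint label t : 'X_{1..n} :=
  if t is A :: t' then (arr A (\bigcup_(B <- t') B) + label t')%MM else 0%MM.

Lemma label_cons A t :
  label (A :: t) = (arr A (\bigcup_(B <- t) B) + label t)%MM.
Proof. by []. Qed.

(** The label is the sum of the exponents of all arrows from a block to a later one. Merging
    neighbours loses just the summand between them, so the coefficient of a merging face is a
    quotient of labels. *)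
Lemma label_merge s t : (s.+1 < size t)%N -> pairwise_disjoint t ->
  label t = (arr (block t s) (block t s.+1) + label (merge_seq s t))%MM.
Proof.
elim: s t => [|s IH] [|A [|B t]] //.
  move=> _ /= /andP[/andP[dAB dA] /andP[dB _]].
  rewrite /merge_seq /block /= drop0 big_cons arrUr ?disjoint_bigcup //.
  by rewrite arrUl //; apply/mnmP=> i; rewrite !mnmDE; lia.
move=> lt_st /andP[_ dt].
rewrite merge_seq_cons !(label_cons A) (IH (B :: t) lt_st dt).
by rewrite (@bigcup_merge _ s (B :: t)) // addmA [X in (X + _)%MM]addmC -addmA.
Qed.

Lemma label_rconsU A t B : pairwise_disjoint (A :: rcons t B) ->
  label (rcons t (A :|: B)) =
    (arr (\bigcup_(C <- t) C) A + label (rcons t B))%MM.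
Proof.
elim: t => [|C t IH] /=.
  move=> _; rewrite !big_nil; apply/mnmP=> i.
  by rewrite !mnmDE !mnm0E !mnmE !big_set0 !inE !muln0.
case/andP=> /andP[dAC dA] /andP[dC dt].
rewrite IH /=; last by rewrite dA.
rewrite !bigcup_rcons big_cons setUCA [arr C (A :|: _)]arrUr; last first.
  by rewrite -bigcup_rcons disjoint_bigcup.
rewrite [arr (C :|: _) A]arrUl; last first.
  by rewrite disjoint_bigcup; move: dC; rewrite all_rcons => /andP[].
apply/mnmP=> i; rewrite !mnmDE; lia.
Qed.

(* The subtraction is exact only when [arr A (~: A) <= m]. *)
Definition fire m A : 'X_{1..n} := (m + arr (~: A) A - arr A (~: A))%MM.

Lemma fireE m A i : fire m A i =
  if i \in A then (m i - \sum_(j in ~: A) G i j)%N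
  else (m i + \sum_(j in A) G i j)%N.
Proof.
rewrite mnmBE mnmDE !mnmE inE; case: (i \in A) => /=.
  by rewrite mul0n mul1n addn0.
by rewrite mul0n mul1n subn0.
Qed.

(** Moving the first block to the end trades its outgoing arrows for the incoming ones from the
    middle blocks; those from the last block remain as the coefficient of the wrapping face. The
    additive form avoids truncated subtraction. *)
Lemma label_wrap t : (1 < size t)%N -> is_cyc t ->
  (arr (~: block t 0) (block t 0) + label t =
   arr (last set0 t) (block t 0) + label (wrap_seq t)
   + arr (block t 0) (~: block t 0))%MM.
Proof.
case: t => // A t; case: (lastP t) => // {}t B _ ct.
have dt := is_cyc_disjoint ct.
have covA: \bigcup_(C <- rcons t B) C = ~: A.
  apply: setU_compl; first by rewrite -(is_cyc_cover ct) big_cons.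
  by case/andP: dt => dA _; rewrite disjoint_bigcup.
rewrite wrap_seq_rcons label_rconsU //= last_rcons /block /= covA.
rewrite -covA {1}bigcup_rcons arrUl; last first.
  move: dt => /= /andP[_]; rewrite -cats1 pairwise_cat allrel1r => /andP[dB _].
  rewrite disjoint_sym disjoint_bigcup.
  by apply: sub_all dB => C; rewrite disjoint_sym.
by apply/mnmP=> i; rewrite !mnmDE; lia.
Qed.

End Exponents.

(** * The differential as a simplicial boundary *)

Lemma ffun_basis (R : pzRingType) (B : finType) (c : {ffun B -> R^o}) :
  c = \sum_u (c u : R) *: [ffun v => (v == u)%:R : R^o].
Proof.
apply/ffunP=> u; rewrite sum_ffunE (bigD1 u) //= !ffunE eqxx.
rewrite [_ *: _]mulr1 big1 ?addr0 // => v nvu.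
by rewrite !ffunE eq_sym (negPf nvu) [_ *: _]mulr0.
Qed.

#[local] Arguments block {n} t s : simpl never.

Section Simplices.

Variables (K : fieldType) (n : nat) (G : digraph n).
Implicit Types (A B : {set 'I_n}) (t : seq {set 'I_n}) (m : 'X_{1..n}).
Implicit Types (p : 'X_{1..n} * seq {set 'I_n}).

(** The index is that of the removed vertex. Without the bottom vertex, the configuration after
    firing the first block becomes the new bottom. *)
Definition face i p :=
  if i is s.+1 then (p.1, merge_seq s p.2)
  else (fire G p.1 (block p.2 0), wrap_seq p.2).

(** The bound on the label amounts to nonnegativity of every vertex of the chain. *)
Definition simplex k p :=
  [&& is_cyc p.2, size p.2 == k.+1 & (label G p.2 <= p.1)%MM].

(** Indexing by raw sequences avoids dependent types and makes degenerate joins, those with an empty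
    block, equal to 0. *)
Definition gen k t : cyc_module K n k :=
  [ffun u : cyc n k.+1 => (blocks u == t :> seq _)%:R].

(* Meant for [simplex k p], which makes the subtraction exact. *)
Definition cell k p : cyc_module K n k :=
  ('X_[p.1 - label G p.2] : {mpoly K[n]}) *: gen k p.2.

Lemma cyc_basisE k (u : cyc n k.+1) : cyc_basis K u = gen k (blocks u).
Proof. by []. Qed.

Lemma gen_eq0 k t : ~~ is_cyc t -> gen k t = 0.
Proof.
move=> nt; apply/ffunP=> u; rewrite !ffunE; case: eqP => // ut.
by move: nt; rewrite -ut blocksP.
Qed.

Lemma arr_block0_le t : is_cyc t ->
  (arr G (block t 0) (~: block t 0) <= label G t)%MM.
Proof.
case: t => [/and4P[_ _ _ /existsP[i]] | A t ct].
  by rewrite inE andbF.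
apply/mnm_lepP=> i; rewrite label_cons mnmDE.
rewrite -(@setU_compl _ A (\bigcup_(B <- t) B)) ?leq_addr //.
  by rewrite -(is_cyc_cover ct) big_cons.
by have /andP[dA _] := is_cyc_disjoint ct; rewrite disjoint_bigcup.
Qed.

Lemma label_fire t m : (1 < size t)%N -> is_cyc t -> (label G t <= m)%MM ->
  (m - label G t + arr G (last set0 t) (block t 0) =
     fire G m (block t 0) - label G (wrap_seq t))%MM
  /\ (label G (wrap_seq t) <= fire G m (block t 0))%MM.
Proof.
move=> t1 ct /mnm_lepP lem.
have labE i := congr1 (fun f : 'X_{1..n} => f i) (label_wrap G t1 ct).
have le_arr := mnm_lepP (arr_block0_le ct).
split; [apply/mnmP=> i | apply/mnm_lepP=> i];
  move: (labE i) (lem i) (le_arr i); rewrite /fire !(mnmDE, mnmBE) //=; lia.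
Qed.

Lemma face_simplex k p i : simplex k.+1 p -> (i < k.+2)%N -> simplex k (face i p).
Proof.
case: p i => m t [|s] /and3P[/= ct /eqP st lt] lti; apply/and3P; split=> /=.
- by rewrite is_cyc_wrap // st.
- by rewrite size_wrap st.
- by have [|//] := label_fire _ ct lt; rewrite st.
- by rewrite is_cyc_merge // st.
- by rewrite Defs.size_merge st.
- apply/mnm_lepP=> i; move/mnm_lepP/(_ i): lt.
  rewrite (@label_merge _ G s t) ?st ?is_cyc_disjoint // mnmDE; lia.
Qed.

(** An entry in [A] loses its arcs into [B] in the first firing and regains them in the second; for
    an entry in [B] it is the reverse. Legality of [A] keeps the first subtraction exact. *)
Lemma fireU m A B : [disjoint A & B] -> (arr G A (~: A) <= m)%MM ->
  fire G m (A :|: B) = fire G (fire G m A) B.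
Proof.
move=> dAB /mnm_lepP leA; apply/mnmP=> i; rewrite !fireE inE.
have := leA i; rewrite mnmE.
have sumC (D J1 J2 : {set 'I_n}) : [disjoint J1 & J2] -> D = J1 :|: J2 ->
    (\sum_(j in D) G i j = \sum_(j in J1) G i j + \sum_(j in J2) G i j)%N.
  by move=> dJ ->; rewrite -bigU //; apply: eq_bigl => j; rewrite !inE.
have dA : [disjoint B & ~: (A :|: B)].
  by apply/pred0P=> j; rewrite /= !inE; case: (j \in B); rewrite ?orbT ?andbF.
have dB : [disjoint A & ~: (A :|: B)].
  by apply/pred0P=> j; rewrite /= !inE; case: (j \in A); rewrite ?orbT ?andbF.
rewrite (sumC (~: A) _ _ dA); last first.
  apply/setP=> j; have := disjointFr dAB (x := j); rewrite !inE.
  by case: (j \in A) (j \in B) => [] [] // /(_ isT).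
rewrite (sumC (~: B) _ _ dB); last first.
  apply/setP=> j; have := disjointFr dAB (x := j); rewrite !inE.
  by case: (j \in A) (j \in B) => [] [] // /(_ isT).
rewrite (sumC (A :|: B) _ _ dAB) //.
have := disjointFr dAB (x := i).
by case: (i \in A) (i \in B) => [] [] /= => [/(_ isT)|/(_ isT)|_|_] //; lia.
Qed.

Lemma face_face k p i j : simplex k.+2 p -> (i < j < k.+3)%N ->
  face i (face j p) = face j.-1 (face i p).
Proof.
case: p => m t sp; case: j => // s /andP[lt_is lts].
have /and3P[/= ct /eqP st lt] := sp.
case: i lt_is => [|r] lt_is; last first.
  rewrite /= -(prednK (leq_ltn_trans (leq0n r) lt_is)) /=.
  by rewrite merge_merge ?st //; lia.
case: s lt_is lts => [|s] _ lts /=; last first.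
  by rewrite block0_merge wrap_merge // st.
rewrite wrap_wrap ?block0_wrap ?st //; congr pair.
have leA := lepm_trans (arr_block0_le ct) lt.
have := is_cyc_disjoint ct; case: t st leA {sp ct lt} => [|A [|B t]] // _ leA.
by move=> /= /andP[/andP[dAB _] _]; rewrite -fireU.
Qed.

Lemma scale_xarrow m A B k t :
  ('X_[m] : {mpoly K[n]}) *: (xarrow K G A B *: gen k t) =
  ('X_[m + arr G A B] : {mpoly K[n]}) *: gen k t.
Proof. by rewrite scalerA xarrowE -mpolyXD. Qed.

Lemma diff_basis k (u : cyc n k.+2) :
  cyc_diff G (gen k.+1 (blocks u)) = cyc_boundary K G u.
Proof.
rewrite /cyc_diff (bigD1 u) //= ffunE eqxx scale1r big1 ?addr0 // => v nvu.
rewrite ffunE; case: eqP => [vu|]; last by rewrite scale0r.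
by case/eqP: nvu; apply/val_inj/val_inj.
Qed.

(** The arrow monomials are absorbed by the change of label and of bottom ([label_merge],
    [label_fire]). The wrapping face, which has sign -1, is face 0; this shifts all signs by one. *)
Lemma diff_cell k p : simplex k.+1 p ->
  cyc_diff G (cell k.+1 p) = \sum_(i < k.+2) (-1) ^+ i.+1 *: cell k (face i p).
Proof.
case: p => m t sp; have /and3P[/= ct st lt] := sp.
pose u := @Cyc n k.+2 (Tuple st) ct.
rewrite {1}/cell [LHS]linearZ /=.
rewrite (diff_basis u).
rewrite /cyc_boundary scalerBr scaler_sumr [RHS]big_ord_recl [LHS]addrC.
rewrite expr1 scaleN1r.
have -> : cell k (face (@ord0 k.+1) (m, t)) =
    ('X_[m - label G t] : {mpoly K[n]}) *:
      (xarrow K G (block u k.+1) (block u 0) *: cyc_basis K (cyc_wrap u)).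
  rewrite cyc_basisE scale_xarrow /cell /=.
  have [|<- _] := label_fire _ ct lt; first by rewrite (eqP st).
  by rewrite /block -nth_last (eqP st).
apply: congr1; apply: eq_bigr => s _.
rewrite lift0 exprS mulN1r exprS mulN1r opprK.
rewrite -scalerA [LHS]scalerA mulrC -[LHS]scalerA; apply: congr1.
rewrite cyc_basisE scale_xarrow /cell /=.
suff -> : (m - label G t + arr G (block t s) (block t s.+1) =
           m - label G (merge_seq s t))%MM by [].
have lab : label G t = (arr G (block t s) (block t s.+1) +
    label G (merge_seq s t))%MM.
  by rewrite -label_merge ?is_cyc_disjoint // (eqP st) !ltnS -ltnS.
apply/mnmP=> i; move/mnm_lepP/(_ i): lt.
rewrite lab !(mnmDE, mnmBE); lia.
Qed.

(** For i < j, the term at (j, i) cancels the one at (i, j - 1). *)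
Lemma simplicial_cancel (R : pzRingType) (V : lmodType R) (N : nat)
    (f : nat -> nat -> V) :
  (forall i j, (i < j <= N)%N -> f j i = f i j.-1) ->
  \sum_(j < N.+1) \sum_(i < N) (-1) ^+ (i + j) *: f j i = 0.
Proof.
move=> fE.
have splitE j : \sum_(i < N) (-1) ^+ (i + j) *: f j i =
    \sum_(i < N | (i < j)%N) (-1) ^+ (i + j) *: f j i +
    \sum_(i < N | (j <= i)%N) (-1) ^+ (i + j) *: f j i.
  rewrite (bigID (fun i : 'I_N => (i < j)%N)) /=; congr (_ + _).
  by apply: eq_bigl => i; rewrite -leqNgt.
under eq_bigr do rewrite splitE.
rewrite big_split /= [X in _ + X]big_ord_recr /= [X in _ + (_ + X)]big1 ?addr0.
  rewrite (exchange_big_dep predT) //= -big_split big1 // => i _ /=.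
  rewrite [X in X + _]big_mkcond big_ord_recl /= add0r -big_mkcond.
  rewrite -big_split big1 // => j; rewrite /bump /= add1n => le_ij.
  rewrite fE /=; last by rewrite le_ij ltn_ord.
  by rewrite addnS exprS mulN1r scaleNr [(j + i)%N]addnC addNr.
by move=> i; rewrite leqNgt ltn_ord.
Qed.

Lemma diff_diff_cell k p : simplex k.+2 p ->
  cyc_diff G (cyc_diff G (cell k.+2 p)) = 0.
Proof.
move=> sp; rewrite diff_cell // linear_sum.
rewrite -[RHS](@simplicial_cancel {mpoly K[n]} (cyc_module K n k) k.+2
  (fun j i => cell k (face i (face j p)))); last first.
  by move=> i j lt_ij; rewrite (face_face sp).
apply: eq_bigr => j _; rewrite linearZ /= diff_cell; last exact: face_simplex.
rewrite scaler_sumr; apply: eq_bigr => i _; rewrite scalerA -exprD.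
by rewrite addSn addnS !exprS !mulN1r opprK addnC.
Qed.

Lemma cell_gen k m t :
  cell k ((m + label G t)%MM, t) = ('X_[m] : {mpoly K[n]}) *: gen k t.
Proof. by rewrite /cell addmK. Qed.

Lemma module_gen k (c : cyc_module K n k) :
  c = \sum_(u : cyc n k.+1) (c u : {mpoly K[n]}) *: gen k (blocks u).
Proof.
rewrite [LHS](@ffun_basis {mpoly K[n]} (cyc n k.+1) c).
apply: eq_bigr => u _; apply: congr1; apply/ffunP=> v.
by rewrite /gen !ffunE.
Qed.

Lemma simplex_cyc k m (u : cyc n k.+1) :
  simplex k ((m + label G (blocks u))%MM, val (blocks u)).
Proof. by rewrite /simplex /= blocksP size_tuple eqxx lem_addl. Qed.

Lemma diff_gen k (c : cyc_module K n k.+1) : cyc_diff G c =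
  \sum_(u : cyc n k.+2) (c u : {mpoly K[n]}) *: cyc_diff G (gen k.+1 (blocks u)).
Proof.
rewrite {1}(module_gen c) raddf_sum; apply: eq_bigr => u _.
by rewrite [LHS]linearZ.
Qed.

Lemma diff_diff k (c : cyc_module K n k.+2) : cyc_diff G (cyc_diff G c) = 0.
Proof.
have gen0 (u : cyc n k.+3) : cyc_diff G (cyc_diff G (gen k.+2 (blocks u))) = 0.
  rewrite -[gen _ _]scale1r -mpolyX0 -cell_gen diff_diff_cell //.
  exact: simplex_cyc.
rewrite [cyc_diff G c]diff_gen raddf_sum big1 // => u _.
by rewrite [LHS]linearZ /= gen0 scaler0.
Qed.

End Simplices.

(** * Weights decreased by firing *)

Section Laplacian.

Variables (n : nat) (G : digraph n).
Implicit Types (A : {set 'I_n}) (m : 'X_{1..n}) (u : 'I_n -> int).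

(* The Laplacian in a form that is visibly invariant under constants. *)
Definition lap u i : int := \sum_j (G i j)%:Z * (u i - u j).

Lemma laplacianE u i : \sum_j laplacian G i j * u j = lap u i.
Proof.
rewrite /lap (bigD1 i) //= [RHS](bigD1 i) //= subrr mulr0 add0r mxE eqxx.
rewrite -natz natr_sum mulr_suml -big_split; apply: eq_bigr => j nji /=.
by rewrite mxE eq_sym (negPf nji) natz mulNr mulrBr.
Qed.

Lemma lap_indicator A i :
  lap (fun j => (j \in A)%:R) i = (arr G A (~: A) i)%:Z - (arr G (~: A) A i)%:Z.
Proof.
rewrite !mnmE /lap inE.
case: (i \in A) => /=.
  rewrite mul1n mul0n subr0 -natz natr_sum [RHS]big_mkcond /=.
  by apply: eq_bigr => j _; rewrite inE (natz (G i j)); case: (j \in A);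
    rewrite /= ?subrr ?mulr0 // subr0 mulr1.
rewrite mul1n mul0n sub0r -natz natr_sum -sumrN [RHS]big_mkcond /=.
by apply: eq_bigr => j _; rewrite (natz (G i j)) sub0r mulrN; case: (j \in A);
  rewrite /= ?mulr1 ?mulr0 ?oppr0.
Qed.

Lemma fire_lap A m i : (arr G A (~: A) <= m)%MM ->
  (fire G m A i)%:Z = (m i)%:Z - lap (fun j => (j \in A)%:R) i.
Proof.
move/mnm_lepP/(_ i); rewrite lap_indicator /fire mnmBE mnmDE; lia.
Qed.

End Laplacian.

Section Weights.

Variables (n : nat) (G : digraph n.+1).
Hypothesis connG : strongly_connected G.
Implicit Types (A : {set 'I_n.+1}) (m : 'X_{1..n.+1}) (u : 'I_n.+1 -> int).

(** At a negative minimum, nonnegativity of the Laplacian forces every out-neighbour to attain the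
    minimum too. A path to [ord_max] carries it to a vertex where [u] is 0. *)
Lemma lap_min_principle u : u ord_max = 0 ->
  (forall i, i != ord_max -> 0 <= lap G u i) -> forall i, 0 <= u i.
Proof.
move=> u0 lap_ge0.
have [i0 _ min_i0] := arg_minP u (erefl (predT ord_max)).
suff u_ge0 : 0 <= u i0 by move=> i; apply: le_trans u_ge0 (min_i0 _ _).
rewrite leNgt; apply/negP => u_lt0.
have [p] := connectP (connG i0 ord_max).
elim: p {-2}i0 (erefl (u i0)) => [|j p IH] i ui /=.
  by move=> _ e; rewrite -ui -e u0 ltxx in u_lt0.
case/andP=> arc_ij; apply: IH; apply/eqP; apply: contraTT arc_ij => nu_ij.
rewrite /Defs.arc lt0n negbK; apply: contraTT (lap_ge0 i _) => [nz_ij|]; last first.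
  by apply: contraTneq u_lt0 => ei; rewrite -ui ei u0 ltxx.
have le_u k : u i <= u k by rewrite ui min_i0.
rewrite -ltNge /lap (bigD1 j) //= ltr_wnDr //.
  by apply: sumr_le0 => k _; rewrite mulr_ge0_le0 // subr_le0.
have lt_ij : u i < u j by rewrite lt_neqAle le_u ui eq_sym nu_ij.
by rewrite pmulr_rlt0 ?subr_lt0 // ltz_nat lt0n.
Qed.

(** Let [R] be the Laplacian without its last row and column. Its inverse is nonnegative by the
    minimum principle, so the column sums [y] of [s * \adj R], which is |det R| times the inverse,
    are nonnegative integers, and [y] times [R] has all entries |det R| > 0. The last weight is
    0. *)
Lemma exists_weights : exists w : 'I_n.+1 -> nat,
  forall j, j != ord_max -> 0 < \sum_i (w i)%:Z * laplacian G i j.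
Proof.
pose ext (x : 'cV[int]_n) i := if unlift ord_max i is Some k then x k 0 else 0.
have ext_max x : ext x ord_max = 0 by rewrite /ext unlift_none.
have ext_lift x k : ext x (lift ord_max k) = x k 0 by rewrite /ext liftK.
pose R : 'M[int]_n :=
  \matrix_(i, j) laplacian G (lift ord_max i) (lift ord_max j).
have Rlap (x : 'cV_n) k : (R *m x) k 0 = lap G (ext x) (lift ord_max k).
  rewrite -laplacianE mxE [RHS]big_ord_recr /=.
  rewrite ext_max mulr0 addr0; apply: eq_bigr => j _.
  have -> : widen_ord (leqnSn n) j = lift ord_max j.
    by apply: val_inj; rewrite /= /bump leqNgt ltn_ord.
  by rewrite ext_lift mxE.
have R_ge0 (x : 'cV_n) : (forall k, 0 <= (R *m x) k 0) -> forall k, 0 <= x k 0.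
  move=> Rx k; have := @lap_min_principle (ext x) _ _ (lift ord_max k).
  rewrite ext_max ext_lift; apply=> // i ni.
  by case: (unliftP ord_max i) ni => [l -> _|->]; rewrite ?eqxx // -Rlap.
(* A kernel vector and its negative both have nonnegative image, so both are nonnegative. *)
have detR : \det R != 0.
  apply/negP; rewrite -det_tr => /det0P [v nv vR].
  case/eqP: nv; apply/rowP=> k; rewrite mxE; apply/eqP; rewrite eq_le.
  have Rv : R *m v^T = 0 by rewrite -[R]trmxK -trmx_mul vR trmx0.
  have := R_ge0 v^T _ k; have := R_ge0 (- v^T) _ k.
  rewrite mulmxN Rv !mxE oppr_ge0 => v_le0 v_ge0.
  by rewrite v_le0 ?v_ge0 // => l; rewrite !mxE ?oppr0.
pose s := Num.sg (\det R).
have adj_ge0 i j : 0 <= s * (\adj R) i j.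
  have := R_ge0 (s *: col j (\adj R)) _ i; rewrite !mxE; apply=> k.
  rewrite -scalemxAr colE mulmxA mul_mx_adj -colE !mxE mulrnAr.
  by rewrite -normrEsg mulrn_wge0.
pose y k := \sum_j s * (\adj R) j k.
exists (fun i => if unlift ord_max i is Some k then `|y k|%N else 0%N) => j.
case: (unliftP ord_max j) => [l -> _ {j} | ->]; last by rewrite eqxx.
rewrite big_ord_recr /= unlift_none mul0r addr0.
rewrite (eq_bigr (fun k => \sum_j s * (\adj R) j k * R k l)) => [|k _].
  have sumE j : \sum_k s * (\adj R) j k * R k l = `|\det R| *+ (j == l).
    under eq_bigr do rewrite -mulrA.
    rewrite -mulr_sumr normrEsg -mulrnAr -/s; apply: congr1.
    by have := congr1 (fun M : 'M_n => M j l) (mul_adj_mx R); rewrite !mxE.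
  rewrite exchange_big; under eq_bigr do rewrite sumE.
  rewrite (bigD1 l) //= eqxx big1 ?addr0 ?normr_gt0 // => j nj.
  by rewrite (negPf nj).
have -> : widen_ord (leqnSn n) k = lift ord_max k.
  by apply: val_inj; rewrite /= /bump leqNgt ltn_ord.
rewrite liftK -mulr_suml [R k l]mxE; congr (_ * _).
by rewrite gez0_abs // sumr_ge0.
Qed.

Definition wt (w : 'I_n.+1 -> nat) m : nat := (\sum_i w i * m i)%N.

Definition fire_decreasing (w : 'I_n.+1 -> nat) : Prop :=
  forall A m, ord_max \notin A -> A != set0 -> (arr G A (~: A) <= m)%MM ->
    (wt w (fire G m A) < wt w m)%N.

(** Firing [A] lowers the weight by the sum over [A] of the entries of the weight vector times the
    Laplacian. *)
Lemma exists_fire_decreasing : exists w, fire_decreasing w.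
Proof.
have [w w_gt0] := exists_weights; exists w => A m nA /set0Pn[a aA] leA.
have wtE x : (wt w x)%:Z = \sum_i (w i)%:Z * (x i)%:Z.
  by rewrite -natz natr_sum; apply: eq_bigr => i _; rewrite natrM !natz.
rewrite -ltz_nat !wtE; under eq_bigr do rewrite fire_lap // mulrBr.
rewrite sumrB gtrBl.
rewrite (eq_bigr (fun i => \sum_(j in A) (w i)%:Z * laplacian G i j)).
  rewrite exchange_big (bigD1 a) //= ltr_pwDl //.
    by rewrite w_gt0 //; apply: contraNneq nA => <-.
  apply: sumr_ge0 => j /andP[jA _]; apply: ltW.
  by rewrite w_gt0 //; apply: contraNneq nA => <-.
move=> i _; rewrite -mulr_sumr -laplacianE; congr (_ * _).
rewrite [RHS]big_mkcond; apply: eq_bigr => j _.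
by case: (j \in A); rewrite ?mulr1 ?mulr0.
Qed.

End Weights.

(** * Joining with the largest legal firing *)

Section Insertion.

Variables (n : nat) (G : digraph n.+1).
Implicit Types (A B : {set 'I_n.+1}) (t : seq {set 'I_n.+1}).
Implicit Types (m : 'X_{1..n.+1}) (p : 'X_{1..n.+1} * seq {set 'I_n.+1}).

Definition legal m A := (ord_max \notin A) && (arr G A (~: A) <= m)%MM.

Definition amax m := \bigcup_(A | legal m A) A.

(** A vertex of [A] pays only for arcs leaving the set, and fewer arcs leave the union. *)
Lemma legalU m A B : legal m A -> legal m B -> legal m (A :|: B).
Proof.
case/andP=> nA /mnm_lepP lA /andP[nB /mnm_lepP lB].
rewrite /legal inE negb_or nA nB; apply/mnm_lepP=> i.
have le_sum (C : {set 'I_n.+1}) : ~: (A :|: B) \subset C ->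
    (\sum_(j in ~: (A :|: B)) G i j <= \sum_(j in C) G i j)%N.
  move/subsetP=> sC; rewrite [X in (_ <= X)%N](bigID (mem (~: (A :|: B)))) /=.
  rewrite -[X in (X <= _)%N]addn0 leq_add //.
  rewrite [X in (X <= _)%N](eq_bigl
    (fun j => (j \in C) && (j \in ~: (A :|: B)))) //.
  by move=> j; case: (boolP (j \in ~: _)) => [/sC -> | _]; rewrite ?andbF.
rewrite mnmE inE.
case: (boolP (i \in A)) => [iA | _] /=.
  have := lA i; rewrite mnmE iA !mul1n; apply: leq_trans.
  by apply: le_sum; rewrite setCS subsetUl.
case: (boolP (i \in B)) => [iB | _] //=.
have := lB i; rewrite mnmE iB !mul1n; apply: leq_trans.
by apply: le_sum; rewrite setCS subsetUr.
Qed.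

Lemma legal_amax m : legal m (amax m).
Proof.
apply: (big_ind (legal m)) => //; last exact: legalU.
by rewrite /legal inE; apply/mnm_lepP=> i; rewrite mnmE inE.
Qed.

Lemma legal_sub m A : legal m A -> A \subset amax m.
Proof. exact: bigcup_sup. Qed.

Lemma is_cyc_last t : is_cyc t -> ord_max \in last set0 t.
Proof.
case/and4P=> _ _ _ /existsP[i /andP[/eqP [ei] il]].
by have <- : i = ord_max by apply: val_inj.
Qed.

Lemma is_cyc_rcons t B : is_cyc (rcons t B) ->
  [/\ \bigcup_(A <- t) A = ~: B, all (fun A => [disjoint A & B]) t
    & pairwise_disjoint t].
Proof.
move=> ct; have := is_cyc_disjoint ct.
rewrite -cats1 pairwise_cat allrel1r => /and3P[dB dt _]; split=> //.
apply: setU_compl; first by rewrite setUC -bigcup_rcons is_cyc_cover.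
rewrite disjoint_bigcup.
by apply: sub_all dB => C; rewrite disjoint_sym.
Qed.

Lemma block_sub_last t s : is_cyc t -> (s.+1 < size t)%N ->
  block t s \subset ~: last set0 t.
Proof.
case: (lastP t) => // {}t B ct; rewrite size_rcons last_rcons ltnS => lt_s.
have [_ dB _] := is_cyc_rcons ct.
by rewrite -disjoints_subset /block nth_rcons lt_s (allP dB) // mem_nth.
Qed.

(** The label at a vertex outside the last block also counts its arcs into the last block. Hence the
    top vertex of a simplex never fires more than [amax G m]. *)
Lemma legal_last t m : is_cyc t -> (label G t <= m)%MM ->
  legal m (~: last set0 t).
Proof.
move=> ct /mnm_lepP lem; rewrite /legal inE negbK is_cyc_last // setCK.
apply/mnm_lepP=> i; apply: leq_trans (lem i); move: ct {m lem}.
case: (lastP t) => [/is_cyc_last|{}t B ct]; first by rewrite inE.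
rewrite last_rcons; have [<- dB dt] := is_cyc_rcons ct.
elim: t dB dt {ct} => [|C t IH] /=.
  by rewrite big_nil mnmE inE.
case/andP=> dCB dB /andP[dC dt]; rewrite bigcup_rcons big_cons.
rewrite arrUl ?disjoint_bigcup // arrUr; last first.
  by rewrite disjoint_sym disjoint_bigcup;
    apply: sub_all dB => D; rewrite disjoint_sym.
have := IH dB dt; rewrite !mnmDE; lia.
Qed.

Lemma label_last0 t B i : is_cyc (rcons t B) -> i \in B ->
  label G (rcons t B) i = 0%N.
Proof.
move=> ct iB; have [_ dB _] := is_cyc_rcons ct.
elim: t dB {ct} => [|C t IH] /= => [_ | /andP[dC dB]].
  by rewrite big_nil mnmDE mnmE big_set0 muln0 mnm0E.
by rewrite mnmDE mnmE (disjointFl dC iB) IH.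
Qed.

(** The chain extended on top by the vertex obtained by firing [A], when [A] contains all blocks but
    the last. If the last block misses [A], that vertex is already the top one, and an empty block
    marks the join as degenerate. *)
Definition ins A t :=
  rcons (rcons (take (size t).-1 t) (last set0 t :&: A)) (~: A).

Lemma ins_rcons A t B : ins A (rcons t B) = rcons (rcons t (B :&: A)) (~: A).
Proof.
by rewrite /ins size_rcons last_rcons /= -[in take _ _]cats1 take_size_cat.
Qed.

Lemma merge_ins_last A t : (0 < size t)%N -> ~: last set0 t \subset A ->
  merge_seq (size t).-1 (ins A t) = t.
Proof.
case: (lastP t) => // {}t B _; rewrite last_rcons size_rcons => sBA.
rewrite ins_rcons merge_last; congr rcons.
apply/setP=> i; move/subsetP/(_ i): sBA; rewrite !inE.
by case: (i \in A); case: (i \in B) => //= /(_ isT).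
Qed.

(** Removing an old vertex commutes with the join. The inclusion matters when the old top vertex is
    removed: the enlarged last block is then cut by [A] so that the block before it stays whole. *)
Lemma merge_ins A s t : (s.+1 < size t)%N -> block t (size t).-2 \subset A ->
  merge_seq s (ins A t) = ins A (merge_seq s t).
Proof.
case: (lastP t) => // {}t B; rewrite size_rcons !ltnS => lt_s.
case: (lastP t) lt_s => // {}t C; rewrite size_rcons ltnS => lt_s.
rewrite /block /= !nth_rcons size_rcons leqnn ltnn eqxx => sCA.
rewrite ins_rcons; case: (ltngtP s (size t)) lt_s => // [lt_s | ->] _.
  rewrite merge_rcons ?size_rcons ?ltnS ?(ltnW lt_s) //.
  by rewrite !(@merge_rcons _ s (rcons t C)) ?size_rcons // ins_rcons.
rewrite merge_rcons ?size_rcons ?ltnS ?leqnn // !merge_last ins_rcons.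
by rewrite setIUl (setIidPl sCA).
Qed.

(** If firing [A] already gives the top vertex, removing it and joining again restores the chain. *)
Lemma ins_merge_last A t : (1 < size t)%N -> block t (size t).-2 \subset A ->
  ~: A = last set0 t -> ins A (merge_seq (size t).-2 t) = t.
Proof.
case: (lastP t) => // {}t B; rewrite size_rcons ltnS last_rcons.
case: (lastP t) => // {}t C _; rewrite size_rcons /block /= !nth_rcons.
rewrite size_rcons leqnn ltnn eqxx => sCA cA.
rewrite merge_last ins_rcons -cA.
by rewrite setIUl [~: A :&: A]setIC setICr setU0 (setIidPl sCA).
Qed.

Lemma is_cyc_ins A t : is_cyc t -> ~: last set0 t \subset A -> ord_max \notin A ->
  last set0 t :&: A != set0 -> is_cyc (ins A t).
Proof.
case: (lastP t) => [/is_cyc_last | {}t B ct]; first by rewrite inE.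
rewrite last_rcons ins_rcons => sBA nA BA0.
have [covt dB dt] := is_cyc_rcons ct.
apply/and4P; split.
- rewrite mem_rcons inE mem_rcons inE !negb_or ![set0 == _]eq_sym BA0.
  have /and4P[+ _ _ _] := ct; rewrite mem_rcons inE negb_or => /andP[_ ->].
  by rewrite !andbT; apply/set0Pn; exists ord_max; rewrite inE.
- rewrite -!cats1 !pairwise_cat !allrel1r /= !andbT dt andbT.
  have dA C : C \in t -> [disjoint C & B].
    by move=> Ct; apply: (allP dB).
  rewrite all_cat /= andbT -andbA; apply/and3P; split.
  + apply/allP=> C Ct; rewrite -setI_eq0; apply/eqP/setP=> i; rewrite !inE.
    apply/negP=> /andP[iC]; apply/negP; rewrite negbK.
    by apply: (subsetP sBA); rewrite inE (disjointFr (dA _ Ct)).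
  + by rewrite -setI_eq0 -setIA setICr setI0.
  + apply/allP=> C Ct; rewrite disjoint_sym.
    by apply: disjointWl (subsetIl _ _) _; rewrite disjoint_sym dA.
- rewrite !bigcup_rcons covt; apply/eqP/setP=> i; rewrite !inE.
  by case: (i \in A); case: (i \in B).
- by apply/existsP; exists ord_max; rewrite eqxx last_rcons inE.
Qed.

(** The join raises the label only on the last block, where the old label is 0; there the bound is
    legality of [amax G m]. *)
Lemma simplex_ins k m t : simplex G k (m, t) ->
  last set0 t :&: amax m != set0 -> simplex G k.+1 (m, ins (amax m) t).
Proof.
case/and3P=> /= ct /eqP st lt BA0.
have sBA : ~: last set0 t \subset amax m by apply/legal_sub/legal_last.
have /andP[nA lA] := legal_amax m.
have cins := is_cyc_ins ct sBA nA BA0.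
have sins : size (ins (amax m) t) = k.+2.
  by rewrite /ins !size_rcons size_takel ?st.
rewrite /simplex /= cins sins eqxx /=.
apply/mnm_lepP=> i.
rewrite (@label_merge _ G k) ?sins ?is_cyc_disjoint //.
have -> : merge_seq k (ins (amax m) t) = t.
  by rewrite -{2}[t](merge_ins_last (A := amax m)) ?st.
have -> : block (ins (amax m) t) k.+1 = ~: amax m.
  by rewrite /block /ins nth_rcons size_rcons size_takel ?st //= ltnn eqxx.
have -> : block (ins (amax m) t) k = last set0 t :&: amax m.
  rewrite /block /ins !nth_rcons size_rcons size_takel ?st //=.
  by rewrite ltnn eqxx leqnn.
rewrite mnmDE mnmE inE; case: (boolP (i \in last set0 t)) => /= [iB | _].
  case: (lastP t) ct st iB lt {sBA BA0 cins sins} => // {}t B ct _ iB _.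
  rewrite last_rcons in iB; rewrite label_last0 // addn0.
  by move/mnm_lepP/(_ i): lA; rewrite mnmE.
by rewrite mul0n; exact: (mnm_lepP lt).
Qed.

End Insertion.

(** * The contracting homotopy *)

Section LinearExtension.

Variables (K : fieldType) (n : nat) (V : lmodType {mpoly K[n]}).
Variable f : 'X_{1..n} -> V.
Implicit Types (p q : {mpoly K[n]}).

(* The [K]-linear extension of [f] from monomials to polynomials. *)
Definition lext p : V := \sum_(m <- msupp p) (p@_m)%:MP *: f m.

(** A common index set lets polynomials of different supports be compared termwise. *)
Lemma lextwE d p : (msize p <= d)%N ->
  lext p = \sum_(m : 'X_{1..n < d}) (p@_m)%:MP *: f m.
Proof.
move=> le_pd; pose I : subFinType _ := 'X_{1..n < d}.
rewrite /lext (big_mksub I) //=; first last.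
- by move=> x /msize_mdeg_lt /leq_trans; apply.
- exact: msupp_uniq.
rewrite big_rmcond //= => i; move/memN_msupp_eq0 ->; exact: scale0r.
Qed.

Lemma lextD : {morph lext : p q / p + q}.
Proof.
move=> p q; pose d := maxn (msize (p + q)) (maxn (msize p) (msize q)).
rewrite !(@lextwE d) /d ?leq_max ?leqnn ?orbT // -big_split.
by apply: eq_bigr => m _ /=; rewrite -scalerDl -mpolyCD mcoeffD.
Qed.

Lemma lextC a p : lext (a%:MP * p) = a%:MP *: lext p.
Proof.
pose d := maxn (msize (a%:MP * p)) (msize p).
rewrite !(@lextwE d) /d ?leq_max ?leqnn ?orbT // scaler_sumr.
by apply: eq_bigr => m _; rewrite scalerA mcoeffCM mpolyCM.
Qed.

Lemma lextX m : lext 'X_[m] = f m.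
Proof. by rewrite /lext msuppX big_seq1 mcoeffX eqxx scale1r. Qed.

End LinearExtension.

Section Filtration.

Variables (K : fieldType) (n : nat) (G : digraph n.+1) (w : 'I_n.+1 -> nat).
Implicit Types (A B : {set 'I_n.+1}) (t : seq {set 'I_n.+1}).
Implicit Types (m : 'X_{1..n.+1}) (p : 'X_{1..n.+1} * seq {set 'I_n.+1}).

Hypothesis w_fire : fire_decreasing G w.

Local Notation F k := (cyc_module K n.+1 k).

Lemma diff0 k : cyc_diff G (0 : F k.+1) = 0.
Proof. exact: linear0. Qed.

Lemma diffD k (c d : F k.+1) : cyc_diff G (c + d) = cyc_diff G c + cyc_diff G d.
Proof. exact: linearD. Qed.

Lemma diffZ k a (c : F k.+1) : cyc_diff G (a *: c) = a *: cyc_diff G c.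
Proof. exact: linearZ. Qed.

(* All cells of [c] have bottom vertices of weight less than [N]. *)
Definition low k N (c : F k) : Prop :=
  forall (u : cyc n.+1 k.+1) m, m \in msupp (c u : {mpoly K[n.+1]}) ->
    (wt w (m + label G (blocks u)) < N)%N.

Lemma low0 k N : low N (0 : F k).
Proof. by move=> u m; rewrite (ffunE _ u) msupp0. Qed.

Lemma lowD k N (c d : F k) : low N c -> low N d -> low N (c + d).
Proof.
move=> lc ld u m; have -> : (c + d) u = c u + d u by exact: ffunE.
by move/msuppD_le; rewrite mem_cat => /orP[/lc|/ld].
Qed.

Lemma lowC k N a (c : F k) : low N c -> low N (a%:MP *: c).
Proof.
move=> lc u m; have -> : (a%:MP *: c) u = a%:MP * c u by exact: ffunE.
by rewrite mul_mpolyC => /msuppZ_le /lc.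
Qed.

Lemma lowN k N (c : F k) : low N c -> low N (- c).
Proof. by move/(lowC (a := -1)); rewrite mpolyCN mpolyC1 scaleN1r. Qed.

Lemma low_sign k N i (c : F k) : low N c -> low N ((-1) ^+ i *: c).
Proof. by move/(lowC (a := (-1) ^+ i)); rewrite rmorph_sign. Qed.

Lemma cellE k p (u : cyc n.+1 k.+1) : cell K G k p u =
  'X_[p.1 - label G p.2] * (blocks u == p.2 :> seq _)%:R :> {mpoly K[n.+1]}.
Proof.
have -> : cell K G k p u = 'X_[p.1 - label G p.2] * gen K k p.2 u.
  exact: ffunE.
by have -> : gen K k p.2 u = (blocks u == p.2 :> seq _)%:R by exact: ffunE.
Qed.

Lemma low_cell k N p : simplex G k p -> (wt w p.1 < N)%N -> low N (cell K G k p).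
Proof.
case: p => m t /and3P[/= ct st lt] ltN u m'.
rewrite cellE /=; case: eqP => [->|_]; last by rewrite mulr0 msupp0.
by rewrite mulr1 msuppX inE => /eqP ->; rewrite submK.
Qed.

Lemma low_bound k (c : F k) : exists N, low N c.
Proof.
exists (\max_(u : cyc n.+1 k.+1)
  \max_(m <- msupp (c u : {mpoly K[n.+1]})) wt w (m + label G (blocks u))).+1.
move=> u m mc; rewrite ltnS.
by apply: leq_trans (leq_bigmax u); apply: (leq_bigmax_seq _ mc).
Qed.

Lemma low0_eq0 k (c : F k) : low 0 c -> c = 0.
Proof.
move=> lc; apply/ffunP=> u; rewrite (ffunE _ u); apply: msuppnil0.
by case: (msupp _) (lc u) => [|m s] // /(_ m); rewrite inE eqxx => /(_ isT).
Qed.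

Lemma module_cell k (c : F k) : c = \sum_(u : cyc n.+1 k.+1)
  \sum_(m <- msupp (c u : {mpoly K[n.+1]})) ((c u : {mpoly K[n.+1]})@_m)%:MP *:
     cell K G k ((m + label G (blocks u))%MM, val (blocks u)).
Proof.
rewrite [LHS]module_gen; apply: eq_bigr => u _.
rewrite {1}[c u]mpolyE scaler_suml; apply: eq_bigr => m _.
by rewrite cell_gen scalerA mul_mpolyC.
Qed.

Lemma low_ind k N (P : F k -> Prop) : P 0 ->
  (forall c d, P c -> P d -> P (c + d)) ->
  (forall a c, P c -> P (a%:MP *: c)) ->
  (forall p, simplex G k p -> (wt w p.1 < N)%N -> P (cell K G k p)) ->
  forall c, low N c -> P c.
Proof.
move=> P0 PD PC Pcell c lc; rewrite (module_cell c).
apply: (big_ind P) => // u _; rewrite big_seq; apply: (big_ind P) => // m mc.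
by apply/PC/Pcell; [apply: simplex_cyc | apply: lc].
Qed.

(** The first block is non-empty, avoids [ord_max] and is legal at the bottom vertex. *)
Lemma wt_face0 k p : simplex G k.+1 p -> (wt w (face G 0 p).1 < wt w p.1)%N.
Proof.
case: p => m t /and3P[/= ct /eqP st lt]; apply: w_fire.
- have := is_cyc_last ct; have := is_cyc_disjoint ct.
  case: t ct st lt => [|A t] // _ []; case: (lastP t) => // {}t B _ _ /=.
  rewrite last_rcons all_rcons => /andP[/andP[dAB _] _] nB.
  by rewrite /block /= (disjointFl dAB nB).
- by apply: block_neq0; rewrite ?st.
- exact: lepm_trans (arr_block0_le _ ct) lt.
Qed.

(** The sign gives the face opposite the new vertex coefficient 1 in the differential. *)
Definition hcell k p : F k.+1 :=
  (-1) ^+ k *: cell K G k.+1 (p.1, ins (amax G p.1) p.2).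

Definition hcyc k (u : cyc n.+1 k.+1) m : F k.+1 :=
  hcell k ((m + label G (blocks u))%MM, val (blocks u)).

(** The extension from cells is only [K]-linear, since [amax] depends on the monomial. *)
Definition htpy k (c : F k) : F k.+1 :=
  \sum_(u : cyc n.+1 k.+1) lext (hcyc u) (c u).

Lemma htpyD k (c d : F k) : htpy (c + d) = htpy c + htpy d.
Proof.
rewrite /htpy -big_split; apply: eq_bigr => u _ /=.
by rewrite -lextD; congr lext; apply: ffunE.
Qed.

Lemma htpyC k a (c : F k) : htpy (a%:MP *: c) = a%:MP *: htpy c.
Proof.
rewrite /htpy scaler_sumr; apply: eq_bigr => u _ /=.
by rewrite -lextC; congr lext; apply: ffunE.
Qed.

Lemma htpy0 k : htpy (0 : F k) = 0.
Proof. by rewrite -(scale0r 0) -mpolyC0 htpyC mpolyC0 scale0r. Qed.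

Lemma htpy_sign k i (c : F k) : htpy ((-1) ^+ i *: c) = (-1) ^+ i *: htpy c.
Proof. by have := htpyC ((-1) ^+ i) c; rewrite rmorph_sign. Qed.

Lemma htpy_sum k I (r : seq I) (f : I -> F k) :
  htpy (\sum_(i <- r) f i) = \sum_(i <- r) htpy (f i).
Proof. exact: (big_morph _ (@htpyD k) (htpy0 k)). Qed.

Lemma htpy_cell k p : simplex G k p -> htpy (cell K G k p) = hcell k p.
Proof.
case: p => m t /and3P[/= ct st lt].
pose u := @Cyc n.+1 k.+1 (Tuple st) ct.
rewrite /htpy (bigD1 u) //= big1 ?addr0 => [|v nvu].
  by rewrite cellE eqxx mulr1 lextX /hcyc /= submK.
rewrite cellE /= -[t]/(val (val u)) !(inj_eq val_inj) (negPf nvu) mulr0.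
by rewrite -[0](mul0r 0) -{1}mpolyC0 lextC mpolyC0 scale0r.
Qed.

Lemma cell_ins0 k m t : last set0 t :&: amax G m == set0 ->
  cell K G k (m, ins (amax G m) t) = 0.
Proof.
move=> BA0; rewrite /cell gen_eq0 ?scaler0 // /is_cyc /ins.
by rewrite mem_rcons inE mem_rcons inE ![set0 == _]eq_sym BA0 orbT.
Qed.

Lemma low_hcell k N p : simplex G k p -> (wt w p.1 < N)%N -> low N (hcell k p).
Proof.
case: p => m t sp ltN; apply: low_sign.
have [BA0|BA0] := eqVneq (last set0 t :&: amax G m) set0.
  by rewrite cell_ins0 ?BA0 //; apply: low0.
by apply: low_cell => //; apply: simplex_ins.
Qed.

(** All faces but face 0 keep the bottom [m], hence are joined with the same vertex. *)
Lemma sum_hcell_faces k m t : simplex G k.+1 (m, t) ->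
  \sum_(i < k.+2) (-1) ^+ i.+1 *: hcell k (face G i (m, t)) =
  - hcell k (face G 0 (m, t)) +
  \sum_(s < k.+1) (-1) ^+ (s + k) *:
     cell K G k.+1 (m, ins (amax G m) (merge_seq s t)).
Proof.
move=> sp; rewrite big_ord_recl expr1 scaleN1r; apply: congr1.
apply: eq_bigr => s _; rewrite lift0 /hcell scalerA /=.
by rewrite !exprS !mulN1r opprK exprD.
Qed.

Lemma cancel_middle (V : zmodType) (x a b c h : V) :
  a + b = 0 -> x + (a + c) + (h + b) - c = x + h.
Proof.
move=> ab; rewrite [a + c]addrC [h + b]addrC !addrA -(addrA (x + c)) ab addr0.
by rewrite addrAC addrK.
Qed.

(** As for a cone, the faces that keep the bottom cancel or return the cell. What survives has lost
    its bottom vertex, and [wt_face0] bounds its weight. *)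
Lemma htpy_cell_low k N p : simplex G k.+1 p -> (wt w p.1 < N.+1)%N ->
  low N (cyc_diff G (htpy (cell K G k.+1 p)) + htpy (cyc_diff G (cell K G k.+1 p))
         - cell K G k.+1 p).
Proof.
case: p => m t sp ltN; rewrite htpy_cell // diff_cell //.
rewrite htpy_sum; under eq_bigr do rewrite htpy_sign.
rewrite (eq_bigr (fun i : 'I_k.+2 =>
  (-1) ^+ i.+1 *: hcell k (face G i (m, t)))); last first.
  by move=> i _; rewrite htpy_cell //; apply: face_simplex.
rewrite sum_hcell_faces //.
have low_f0 q : simplex G k.+2 (m, q) -> low N (cell K G k.+1 (face G 0 (m, q))).
  move=> sq; apply: low_cell; first exact: face_simplex.
  exact: leq_trans (wt_face0 sq) ltN.
have low_h0 : low N (- hcell k (face G 0 (m, t))).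
  apply/lowN/low_hcell; first exact: face_simplex.
  exact: leq_trans (wt_face0 sp) ltN.
have /and3P[/= ct /eqP st lt] := sp.
have sBA : ~: last set0 t \subset amax G m by apply/legal_sub/legal_last.
have sCA : block t k \subset amax G m.
  by apply: subset_trans (block_sub_last ct _) sBA; rewrite st.
(* An empty intersection means that [amax G m] already leads to the top vertex; the join is then
   degenerate. *)
have [BA0|BA0] := eqVneq (last set0 t :&: amax G m) set0.
  have cA : ~: amax G m = last set0 t.
    apply/setP=> i; have /setP/(_ i) := BA0; have /subsetP/(_ i) := sBA.
    by rewrite !inE; case: (i \in amax G m); case: (_ \in _) => //= /(_ isT).
  rewrite {1}/hcell cell_ins0 ?BA0 // scaler0 linear0 add0r.
  rewrite big_ord_recr big1 => [|s _] /=; last first.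
    by rewrite cell_ins0 ?scaler0 // last_merge ?BA0 // st !ltnS.
  (* Removing this top vertex and joining again gives back the cell, with sign (-1)^(k+k) = 1. *)
  have e : ins (amax G m) (merge_seq k t) = t.
    by have := @ins_merge_last _ (amax G m) t; rewrite st; apply.
  by rewrite e add0r addnn -mul2n exprM sqrrN expr1n expr1n scale1r addrK.
have sins := simplex_ins sp BA0.
have dE : cyc_diff G (cell K G k.+2 (m, ins (amax G m) t)) =
    - cell K G k.+1 (face G 0 (m, ins (amax G m) t)) +
    (\sum_(s < k.+1) (-1) ^+ s *:
       cell K G k.+1 (m, ins (amax G m) (merge_seq s t)) +
     (-1) ^+ k.+1 *: cell K G k.+1 (m, t)).
  rewrite diff_cell // big_ord_recl expr1 scaleN1r; apply: congr1.
  rewrite (eq_bigr (fun s : 'I_k.+2 => (-1) ^+ s *: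
    cell K G k.+1 (m, merge_seq s (ins (amax G m) t)))) => [|s _]; last first.
    by rewrite lift0 !exprS !mulN1r opprK.
  rewrite big_ord_recr /=.
  have -> : merge_seq k.+1 (ins (amax G m) t) = t.
    by have := @merge_ins_last _ (amax G m) t; rewrite st; apply.
  apply: (congr1 (fun x => x + _)); apply: eq_bigr => s _.
  have lt_s : (s.+1 < size t)%N by rewrite st ltnS; apply: ltn_ord.
  by rewrite merge_ins // st.
rewrite {1}/hcell [cyc_diff G _]linearZ /= dE !scalerDr scalerA -exprD.
rewrite addnn -mul2n exprM sqrrN expr1n expr1n scale1r scaler_sumr.
rewrite cancel_middle; last first.
  rewrite -big_split big1 // => s _ /=.
  by rewrite scalerA addnC -exprD -scalerDl exprS mulN1r addNr scale0r.
by apply: lowD low_h0; apply/low_sign/lowN/low_f0.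
Qed.

(** For a cycle [c], the difference of [c] and the boundary of [htpy c] is a cycle of smaller weight
    bound; with bound 0 nothing is left. *)
Lemma cycle_boundary k (c : F k.+1) :
  cyc_diff G c = 0 -> exists d, cyc_diff G d = c.
Proof.
have [N] := low_bound c; elim: N c => [|N IH] c lc dc.
  by exists 0; rewrite linear0 (low0_eq0 lc).
have lowP : low N (cyc_diff G (htpy c) + htpy (cyc_diff G c) - c).
  apply: (@low_ind _ _ (fun c => low N (cyc_diff G (htpy c) +
    htpy (cyc_diff G c) - c))) lc => [|c1 c2 l1 l2|a c1 l1|p].
  - by rewrite htpy0 !diff0 htpy0 addr0 subr0; apply: low0.
  - rewrite htpyD !diffD htpyD opprD.
    rewrite (addrACA (cyc_diff G (htpy c1))) (addrACA (cyc_diff G (htpy c1) + _)).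
    exact: lowD.
  - rewrite htpyC !diffZ htpyC -scalerN -!scalerDr.
    exact: lowC.
  - exact: htpy_cell_low.
have [||d dd] := IH (c - cyc_diff G (htpy c)).
- by have := lowN lowP; rewrite dc htpy0 addr0 opprB.
- by rewrite linearB /= dc diff_diff subr0.
by exists (htpy c + d); rewrite linearD /= dd addrC subrK.
Qed.

End Filtration.

(** * Degree zero *)

Section Reduced.

Variables (n : nat) (G : digraph n.+1).
Implicit Types (m : 'X_{1..n.+1}) (u : 'I_n.+1 -> int).

(** Congruence modulo the lattice, witnessed by a firing vector. *)
Definition chip_equiv m1 m2 : Prop :=
  exists u, forall i, (m2 i)%:Z = (m1 i)%:Z - lap G u i.

Lemma lapD u v i : lap G (fun j => u j + v j) i = lap G u i + lap G v i.
Proof. by rewrite -big_split; apply: eq_bigr => j _ /=; ring. Qed.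

Lemma lapN u i : lap G (fun j => - u j) i = - lap G u i.
Proof. by rewrite -sumrN; apply: eq_bigr => j _ /=; ring. Qed.

Lemma chip_equiv_refl m : chip_equiv m m.
Proof.
exists (fun=> 0) => i; rewrite /lap big1 ?subr0 // => j _.
by rewrite mulr0.
Qed.

Lemma chip_equiv_sym m1 m2 : chip_equiv m1 m2 -> chip_equiv m2 m1.
Proof. by case=> u um; exists (fun j => - u j) => i; rewrite lapN um; ring. Qed.

Lemma chip_equiv_trans m1 m2 m3 :
  chip_equiv m1 m2 -> chip_equiv m2 m3 -> chip_equiv m1 m3.
Proof.
by move=> [u um] [v vm]; exists (fun j => u j + v j) => i; rewrite lapD vm um; ring.
Qed.

Lemma chip_equiv_fire m A : (arr G A (~: A) <= m)%MM -> chip_equiv m (fire G m A).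
Proof. by move=> lA; exists (fun j => (j \in A)%:R) => i; rewrite fire_lap. Qed.

(* The set where the firing vector is maximal can be fired legally. *)
Lemma reduced_firing_le m1 m2 u : amax G m1 = set0 ->
  (forall i, (m2 i)%:Z = (m1 i)%:Z - lap G u i) -> forall i, u i <= u ord_max.
Proof.
move=> red1 um.
have [i0 _ max_i0] := arg_maxP u (erefl (predT ord_max)).
suff u_i0 : u i0 <= u ord_max by move=> i; apply: le_trans (max_i0 i _) u_i0.
rewrite leNgt; apply/negP => lt_u.
pose A := [set i | u i == u i0].
suff legalA : legal G m1 A.
  have := subsetP (legal_sub legalA) i0.
  by rewrite red1 !inE eqxx => /(_ isT).
rewrite /legal inE lt_eqF //=; apply/mnm_lepP=> i.
rewrite mnmE inE; case: eqP => //= ui; rewrite mul1n -lez_nat.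
apply: (@le_trans _ _ (lap G u i)); last by have := um i; lia.
rewrite -natz natr_sum big_mkcond; apply: ler_sum => j _ /=.
have := max_i0 j isT; rewrite !inE natz -ui.
have: 0 <= (G i j)%:Z by [].
case: eqP => [->|/eqP ne]; rewrite /= ?subrr ?mulr0 // => ge0 le_ji.
by rewrite -[X in X <= _]mulr1 ler_wpM2l // -gtz0_ge1 subr_gt0 lt_neqAle ne.
Qed.

(** Applied in both directions, [reduced_firing_le] makes the firing vector constant, and the
    Laplacian kills constants. *)
Lemma reduced_unique m1 m2 : amax G m1 = set0 -> amax G m2 = set0 ->
  chip_equiv m1 m2 -> m1 = m2.
Proof.
move=> red1 red2 [u um]; apply/mnmP=> i; apply/eqP; rewrite -eqz_nat um.
have le1 := reduced_firing_le red1 um.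
have /(reduced_firing_le red2) le2 j :
    (m1 j)%:Z = (m2 j)%:Z - lap G (fun k => - u k) j.
  by rewrite lapN um; ring.
rewrite /lap big1 ?subr0 // => j _.
have uE k : u k = u ord_max by apply: le_anti; rewrite le1 -lerN2 le2.
by rewrite uE (uE j) subrr mulr0.
Qed.

End Reduced.

(** * Lattice vectors and their binomials *)

Section LatticeIdealGenerators.

Variables (n : nat) (G : digraph n).
Implicit Types (l : 'cV[int]_n).

Lemma laplacian_mulmx (x : 'cV[int]_n) i :
  (laplacian G *m x) i 0 = lap G (fun j => x j 0) i.
Proof. by rewrite mxE laplacianE. Qed.

Lemma lattice_lap l : lattice (laplacian G) l ->
  exists u, forall i, l i 0 = lap G u i.
Proof.
case=> k [r [s [/choice [j sj] ->]]].
pose x : 'cV[int]_n := \sum_(a < k) r a *: delta_mx (j a) 0.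
exists (fun i => x i 0) => i; rewrite -laplacian_mulmx mulmx_sumr.
suff -> : \sum_a r a *: s a = \sum_a laplacian G *m (r a *: delta_mx (j a) 0) by [].
by apply: eq_bigr => a _; rewrite sj colE scalemxAr.
Qed.

Lemma lattice_indicator (A : {set 'I_n}) :
  lattice (laplacian G) (\col_i lap G (fun j => (j \in A)%:R) i).
Proof.
exists n, (fun j => (j \in A)%:R), (fun j => col j (laplacian G)).
split=> [j|]; first by exists j.
apply/colP=> i; rewrite mxE summxE -laplacianE; apply: eq_bigr => j _.
by rewrite !mxE mulrC.
Qed.

Lemma mnm_pos_neg l i :
  (mnm_neg l i)%:Z = (mnm_pos l i)%:Z - l i 0.
Proof.
by rewrite !mnmE; case: (leP (l i 0) 0); lia.
Qed.

(** The two arrow exponents have disjoint supports, inside and outside [A], so nothing cancels in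
    their difference. *)
Lemma mnm_pos_indicator (A : {set 'I_n}) :
  mnm_pos (\col_i lap G (fun j => (j \in A)%:R) i) = arr G A (~: A).
Proof.
apply/mnmP=> i; rewrite [LHS]mnmE mxE lap_indicator !mnmE inE.
by case: (i \in A); rewrite ?mul0n ?mul1n; case: leP => //; lia.
Qed.

Lemma mnm_neg_indicator (A : {set 'I_n}) :
  mnm_neg (\col_i lap G (fun j => (j \in A)%:R) i) = arr G (~: A) A.
Proof.
apply/mnmP=> i; rewrite [LHS]mnmE mxE lap_indicator !mnmE inE.
by case: (i \in A); rewrite ?mul0n ?mul1n; case: leP => //; lia.
Qed.

End LatticeIdealGenerators.

Lemma lattice_proj_eq0 (K : fieldType) n (L : 'cV[int]_n -> Prop)
    (p : {mpoly K[n]}) : lattice_proj L p = 0 <-> in_lattice_ideal L p.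
Proof.
have proj0 : lattice_proj (K := K) L 0 = 0 by exact: raddf0.
rewrite -proj0; split=> [/eqP|Ip]; last apply/eqP.
  by rewrite /lattice_proj -Quotient.idealrBE subr0 => /asboolP.
by rewrite /lattice_proj -Quotient.idealrBE subr0; apply/asboolP.
Qed.

(** * Exactness at the augmentation *)

Section Augmentation.

Variables (K : fieldType) (n : nat) (G : digraph n.+1) (w : 'I_n.+1 -> nat).
Implicit Types (m : 'X_{1..n.+1}).
Hypothesis w_fire : fire_decreasing G w.

Local Notation F k := (cyc_module K n.+1 k).
Local Notation gen0 := (gen K 0 [:: [set: 'I_n.+1]]).

Definition boundary (c : F 0) : Prop := exists d, cyc_diff G d = c.

Lemma boundary0 : boundary 0.
Proof. by exists 0; apply: diff0. Qed.

Lemma boundaryD c d : boundary c -> boundary d -> boundary (c + d).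
Proof. by case=> [c' <-] [d' <-]; exists (c' + d'); apply: diffD. Qed.

Lemma boundaryZ a c : boundary c -> boundary (a *: c).
Proof. by case=> c' <-; exists (a *: c'); apply: diffZ. Qed.

Lemma label_seq1 (A : {set 'I_n.+1}) : label G [:: A] = 0%MM.
Proof.
by rewrite /= big_nil addm0; apply/mnmP=> i; rewrite mnmE big_set0 muln0 mnm0E.
Qed.

Lemma cell0E p : simplex G 0 p -> cell K G 0 p = 'X_[p.1] *: gen0.
Proof.
case: p => m t /and3P[/= ct st lt].
have := blocks_cyc1 (Cyc (blocks := Tuple st) ct) => /= ->.
rewrite /cell label_seq1; suff -> : (m - 0 = m)%MM by [].
by apply/mnmP=> i; rewrite mnmBE mnm0E subn0.
Qed.

Lemma simplex0 m : simplex G 0 (m, [:: [set: 'I_n.+1]]).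
Proof.
rewrite /simplex [_.2]/= label_seq1; apply/and3P; split=> //; last first.
  by apply/mnm_lepP=> i; rewrite mnm0E.
apply/and4P; split=> //.
- by rewrite inE eq_sym; apply/set0Pn; exists ord_max; rewrite inE.
- by rewrite big_seq1.
- by apply/existsP; exists ord_max; rewrite eqxx inE.
Qed.

(** The two monomials are the endpoints of the edge with blocks [amax G m] and its complement. *)
Lemma boundary_fire m : amax G m != set0 ->
  boundary ('X_[m] *: gen0 - 'X_[fire G m (amax G m)] *: gen0).
Proof.
move=> nA; have sp := simplex_ins (simplex0 m) _; rewrite /= setTI in sp.
have {sp} := sp nA; rewrite /ins /= setTI => sp.
exists (cell K G 1 (m, [:: amax G m; ~: amax G m])).
have cE i : (i < 2)%N -> cell K G 0 (face G i (m, [:: amax G m; ~: amax G m])) =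
    'X_[(face G i (m, [:: amax G m; ~: amax G m])).1] *: gen0.
  by move=> lt_i; apply/cell0E/(face_simplex sp).
rewrite (diff_cell K sp) big_ord_recl big_ord1 expr1 scaleN1r lift0 sqrrN.
by rewrite expr1n scale1r !cE // addrC.
Qed.

(** Firing [amax] repeatedly terminates because the weight decreases. *)
Lemma reduceP m : exists r, [/\ amax G r = set0, chip_equiv G m r
  & boundary ('X_[m] *: gen0 - 'X_[r] *: gen0)].
Proof.
elim: (wt w m).+1 {-2}m (ltnSn (wt w m)) => // N IH {}m lt_m.
have [red|nred] := eqVneq (amax G m) set0.
  exists m; split; [exact: red | exact: chip_equiv_refl |].
  by rewrite subrr; apply: boundary0.
have /andP[nA lA] := legal_amax G m.
have [|r [red mr br]] := IH (fire G m (amax G m)).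
  exact: leq_trans (w_fire nA nred lA) lt_m.
exists r; split; first exact: red.
  by apply: chip_equiv_trans mr; apply: chip_equiv_fire.
have := boundaryD (boundary_fire nred) br.
by rewrite addrA subrK.
Qed.

Lemma boundary_binomial m1 m2 : chip_equiv G m1 m2 ->
  boundary ('X_[m1] *: gen0 - 'X_[m2] *: gen0).
Proof.
have [r1 [red1 mr1 b1]] := reduceP m1; have [r2 [red2 mr2 b2]] := reduceP m2.
move=> m12; have r12 : r1 = r2.
  apply: reduced_unique red1 red2 _; apply: chip_equiv_trans mr2.
  by apply: chip_equiv_trans m12; apply: chip_equiv_sym.
have := boundaryD b1 (boundaryZ (-1) b2).
by rewrite r12 scaleN1r opprB addrA subrK.
Qed.

Lemma gen0E (u : cyc n.+1 1) : gen0 u = 1.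
Proof.
have -> : gen0 u = (blocks u == [:: setT] :> seq _)%:R by exact: ffunE.
by rewrite blocks_cyc1 eqxx.
Qed.

Lemma cyc_module0Z p : cyc_module0 (p *: gen0) = p.
Proof.
have /and3P[/= ct _ _] := simplex0 0.
pose u0 := @Cyc n.+1 1 [tuple [set: 'I_n.+1]] ct.
rewrite /cyc_module0 (bigD1 u0) //= big1 ?addr0 => [|u].
  have -> u : (p *: gen0) u = p * gen0 u by exact: ffunE.
  by rewrite gen0E mulr1.
have -> : u = u0 by apply/val_inj/val_inj; rewrite /= blocks_cyc1.
by rewrite eqxx.
Qed.

Lemma diff_gen1 (u : cyc n.+1 2) : cyc_diff G (gen K 1 (blocks u)) =
  ('X_[arr G (block u 0) (~: block u 0)] -
   'X_[arr G (~: block u 0) (block u 0)]) *: gen0.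
Proof.
rewrite -[gen _ _ _]scale1r -mpolyX0 -(cell_gen K G) add0m.
have := simplex_cyc G 0 u; rewrite add0m.
case: u => -[[|A [|B []]] // st] cu sp.
have BE : B = ~: A.
  have := is_cyc_disjoint cu; rewrite /= !andbT => dAB.
  by apply: setU_compl dAB; rewrite -(is_cyc_cover cu) big_cons big_seq1.
have labE : label G [:: A; B] = arr G A (~: A).
  by rewrite label_cons label_seq1 big_seq1 addm0 BE.
have cE i : (i < 2)%N -> cell K G 0 (face G i (label G [:: A; B], [:: A; B])) =
    'X_[(face G i (label G [:: A; B], [:: A; B])).1] *: gen0.
  by move=> lt_i; apply/cell0E/(face_simplex sp).
rewrite (diff_cell K sp) big_ord_recl big_ord1 expr1 scaleN1r lift0 sqrrN.
rewrite expr1n scale1r !cE // addrC scalerBl.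
have -> : (face G 1 (label G [:: A; B], [:: A; B])).1 = arr G A (~: A) by [].
have -> // : (face G 0 (label G [:: A; B], [:: A; B])).1 = arr G (~: A) A.
by rewrite [LHS]/(fire G _ A) labE /fire addmC addmK.
Qed.

Lemma module0E (c : F 0) : c = cyc_module0 c *: gen0.
Proof.
rewrite [LHS]module_gen /cyc_module0 scaler_suml; apply: eq_bigr => u _.
by rewrite blocks_cyc1.
Qed.

Lemma aug_surj y : exists c, cyc_aug G c = y :> lattice_ring K _.
Proof.
exists (repr y *: gen0); rewrite /cyc_aug cyc_module0Z; exact: reprK.
Qed.

Lemma aug_exact : exact_at (@cyc_diff K n.+1 G 0) (@cyc_aug K n.+1 G).
Proof.
move=> c; rewrite /cyc_aug lattice_proj_eq0; split=> [|[d <-]].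
  case=> k [r [s [sL cE]]]; rewrite -/(boundary c) (module0E c) cE scaler_suml.
  apply: (big_ind boundary) => [|x y|i _].
  - exact: boundary0.
  - exact: boundaryD.
  rewrite -scalerA; apply: boundaryZ.
  have [l Ll ->] := sL i; rewrite scalerBl; apply: boundary_binomial.
  have [u uE] := lattice_lap Ll.
  by exists u => j; rewrite mnm_pos_neg uE.
(* Conversely, the boundary of a two-block partition is the binomial of the lattice vector given by
   the indicator of its first block. *)
apply/lattice_proj_eq0; rewrite -/(cyc_aug G _) diff_gen raddf_sum big1 // => u _.
rewrite [LHS]linearZ /=.
have -> : cyc_aug G (cyc_diff G (gen K 1 (blocks u))) = 0.
  rewrite diff_gen1 /cyc_aug cyc_module0Z; apply/lattice_proj_eq0.
  exists 1%N, (fun=> 1), (fun=> 'X_[arr G (block u 0) (~: block u 0)] -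
    'X_[arr G (~: block u 0) (block u 0)]).
  split=> [_|]; last by rewrite big_ord1 scale1r.
  exists (\col_i lap G (fun j => (j \in block u 0)%:R) i).
    exact: lattice_indicator.
  by rewrite mnm_pos_indicator mnm_neg_indicator.
by rewrite scaler0.
Qed.

End Augmentation.

(** * Minimality *)

Section Span.

Variables (R : pzRingType) (V : lmodType R) (S : V -> Prop).

Lemma in_span0 : in_span S 0.
Proof.
by exists 0%N, (fun=> 0), (fun=> 0); split=> [[]//|]; rewrite big_ord0.
Qed.

Lemma in_span_gen v : S v -> in_span S v.
Proof.
by move=> Sv; exists 1%N, (fun=> 1), (fun=> v); rewrite big_ord1 scale1r.
Qed.

Lemma in_spanD u v : in_span S u -> in_span S v -> in_span S (u + v).
Proof.
case=> [m1 [r1 [s1 [S1 ->]]]] [m2 [r2 [s2 [S2 ->]]]].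
exists (m1 + m2)%N,
  (fun i => match split i with inl j => r1 j | inr j => r2 j end),
  (fun i => match split i with inl j => s1 j | inr j => s2 j end).
split=> [i|]; first by case: (split i).
by rewrite big_split_ord /=; congr (_ + _); apply: eq_bigr => i _;
  rewrite ?(unsplitK (inl i)) ?(unsplitK (inr i)).
Qed.

Lemma in_spanZ a v : in_span S v -> in_span S (a *: v).
Proof.
case=> [m [r [s [Ss ->]]]]; exists m, (fun i => a * r i), s; split=> //.
by rewrite scaler_sumr; apply: eq_bigr => i _; rewrite scalerA.
Qed.

End Span.

Section CyclicPartitions.

Variable n : nat.
Implicit Types t : seq {set 'I_n}.

(** This makes the module above the top degree zero, so that exactness there turns into
    injectivity. *)
Lemma is_cyc_size t : is_cyc t -> (size t <= n)%N.
Proof.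
case/and4P=> t0 dt _ _.
rewrite -[X in (_ <= X)%N]card_ord.
apply: leq_trans (max_card (mem (\bigcup_(A <- t) A))).
elim: t t0 dt => // A t IH; rewrite inE negb_or /= => /andP[A0 t0] /andP[dA dt].
rewrite big_cons cardsU disjoint_setI0 ?disjoint_bigcup // cards0 subn0.
by rewrite -add1n leq_add ?IH // card_gt0 eq_sym.
Qed.

Lemma is_cyc_block_disjoint t r s : is_cyc t -> (r < s < size t)%N ->
  [disjoint block t r & block t s].
Proof.
move=> /is_cyc_disjoint /(pairwiseP set0) dt /andP[lt_rs lt_s].
by apply: dt => //; rewrite inE // (ltn_trans lt_rs).
Qed.

End CyclicPartitions.

Section Minimality.

Variables (K : fieldType) (n : nat) (G : digraph n).

Local Notation F k := (cyc_module K n k).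

Lemma irrelevant_xarrow (I J : {set 'I_n}) : strongly_complete G ->
  I != set0 -> J != set0 -> [disjoint I & J] ->
  irrelevant_ideal (xarrow K G I J).
Proof.
move=> complG /set0Pn[i iI] /set0Pn[j jJ] dIJ.
have := complG i j; rewrite (contraTneq _ iI) => [/(_ isT) Gij|->]; last first.
  by rewrite (disjointFl dIJ jJ).
rewrite /xarrow (bigD1 i) //= (bigD1 j) //=.
rewrite -(prednK Gij) addSn exprS -mulrA mulrC.
by apply: in_spanZ; apply: in_span_gen; exists i.
Qed.

Lemma diff_in_ideal k (c : F k.+1) : strongly_complete G ->
  in_ideal_smul (@irrelevant_ideal K n) (cyc_diff G c).
Proof.
move=> complG; rewrite /in_ideal_smul diff_gen.
have spanE (S : F k -> Prop) (r : seq (cyc n k.+2)) (f : cyc n k.+2 -> F k) :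
    (forall t, in_span S (f t)) -> in_span S (\sum_(t <- r) f t).
  move=> Sf; apply: (big_ind (in_span S)) => //; first exact: in_span0.
  exact: in_spanD.
apply: spanE => u; apply: in_spanZ; rewrite diff_basis /cyc_boundary.
have st : size (blocks u) = k.+2 by rewrite size_tuple.
have xin r s (v : F k) : (r < k.+2)%N -> (s < k.+2)%N -> r != s ->
    in_span (fun v => exists a u, irrelevant_ideal a /\ v = a *: u)
      (xarrow K G (block (blocks u) r) (block (blocks u) s) *: v).
  move=> lt_r lt_s nrs; apply: in_span_gen.
  exists (xarrow K G (block (blocks u) r) (block (blocks u) s)), v; split=> //.
  apply: irrelevant_xarrow complG _ _ _.
  - by rewrite block_neq0 ?blocksP ?st.
  - by rewrite block_neq0 ?blocksP ?st.
  case: (ltngtP r s) nrs => // lt_rs _; last rewrite disjoint_sym.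
    by rewrite is_cyc_block_disjoint ?blocksP // lt_rs st.
  by rewrite is_cyc_block_disjoint ?blocksP // lt_rs st.
apply: in_spanD.
  apply: (big_ind (in_span _)) => [||s _].
  - exact: in_span0.
  - exact: in_spanD.
  rewrite -scalerA; apply/in_spanZ/xin.
  - by rewrite ltnW // ltnS.
  - by rewrite ltnS; apply: ltn_ord.
  - by rewrite neq_ltn ltnSn.
by rewrite -scaleN1r; apply/in_spanZ/xin.
Qed.

Lemma complete_minimal N : strongly_complete G ->
  @minimal {mpoly K[n]} (fun k => cyc n k.+1) (@irrelevant_ideal K n) N
    (fun k => @cyc_diff K n G k).
Proof. by move=> complG k _ c; apply: diff_in_ideal. Qed.

Lemma coef0M (p q : {mpoly K[n]}) : (p * q)@_0 = p@_0 * q@_0.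
Proof. exact: rmorphM. Qed.

Lemma irrelevant_coef0 (p : {mpoly K[n]}) : irrelevant_ideal p -> p@_0 = 0.
Proof.
case=> m [r [s [Ss ->]]]; rewrite raddf_sum big1 // => i _.
have [j ->] := Ss i.
by rewrite [LHS]coef0M mcoeffX mnm1_eq0 mulr0.
Qed.

Lemma in_ideal_coef0 k (c : F k) u :
  in_ideal_smul (@irrelevant_ideal K n) c -> (c u : {mpoly K[n]})@_0 = 0.
Proof.
case=> m [r [s [Ss ->]]].
apply: (big_ind (fun c : F k => (c u : {mpoly K[n]})@_0 = 0)).
- by rewrite (ffunE _ u) mcoeff0.
- move=> x y x0 y0; have -> : (x + y) u = x u + y u by exact: ffunE.
  by rewrite mcoeffD x0 y0 addr0.
move=> i _; have [a [v [aI ->]]] := Ss i; rewrite scalerA.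
have -> : ((r i * a) *: v) u = (r i * a) * v u by exact: ffunE.
by rewrite !coef0M (irrelevant_coef0 aI) mulr0 mul0r.
Qed.

Lemma coef0_scale_basis k (a : {mpoly K[n]}) (t u : cyc n k.+1) :
  ((a *: cyc_basis K t : F k) u : {mpoly K[n]})@_0 = a@_0 * (u == t)%:R.
Proof.
have -> : (a *: cyc_basis K t : F k) u = a * cyc_basis K t u by exact: ffunE.
have -> : cyc_basis K t u = (u == t)%:R by exact: ffunE.
by rewrite coef0M; case: (u == t); rewrite ?mcoeff1 ?eqxx ?mcoeff0.
Qed.

Lemma coef0_boundary3 (t : cyc n 3) (u : cyc n 2) :
  (cyc_boundary K G t u : {mpoly K[n]})@_0 =
    (xarrow K G (block t 0) (block t 1))@_0 * (u == cyc_merge t ord0)%:R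
  - (xarrow K G (block t 1) (block t 2))@_0 * (u == cyc_merge t (lift ord0 ord0))%:R
  - (xarrow K G (block t 2) (block t 0))@_0 * (u == cyc_wrap t)%:R.
Proof.
rewrite /cyc_boundary big_ord_recl big_ord1.
set x := _ *: _; set y := _ *: _; set z := _ *: _.
have -> : (x + y - z) u = x u + y u - z u.
  have -> : (x + y - z) u = (x + y) u + (- z) u by exact: ffunE.
  by congr (_ + _); exact: ffunE.
have xE : (x u : {mpoly K[n]})@_0 = _ := coef0_scale_basis _ _ _.
have yE : (y u : {mpoly K[n]})@_0 = _ := coef0_scale_basis _ _ _.
have zE : (z u : {mpoly K[n]})@_0 = _ := coef0_scale_basis _ _ _.
clearbody x y z; rewrite mcoeffB mcoeffD xE yE zE.
by rewrite expr0 mul1r expr1 mulN1r mcoeffN mulNr.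
Qed.

End Minimality.

(** * Minimality forces every arc *)

Section MinimalImpliesComplete.

Variables (K : fieldType) (n : nat) (G : digraph n.+1).
Implicit Types A B C : {set 'I_n.+1}.

Lemma is_cyc3 A B C : A != set0 -> B != set0 -> ord_max \in C ->
  [disjoint A & B] -> [disjoint A & C] -> [disjoint B & C] ->
  A :|: (B :|: C) = setT -> is_cyc [:: A; B; C].
Proof.
move=> A0 B0 mC dAB dAC dBC cov; apply/and4P; split.
- rewrite !inE !negb_or ![set0 == _]eq_sym A0 B0 /=.
  by apply/set0Pn; exists ord_max.
- by rewrite /= dAB dAC dBC.
- by rewrite !big_cons big_nil setU0 cov.
- by apply/existsP; exists ord_max; rewrite eqxx.
Qed.

Lemma disjoint_setU_neq A B : B != set0 -> [disjoint A & B] -> A :|: B != A.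
Proof.
case/set0Pn=> b bB dAB; apply: contraTneq bB => /setP/(_ b); rewrite inE.
move=> + ; apply: contra_eqN => bB.
by rewrite (disjointFl dAB bB) bB.
Qed.

(** The three faces have distinct first blocks [A :|: B], [A] and [B], so their coefficients cannot
    mix. *)
Lemma minimal_coef0 A B C : is_cyc [:: A; B; C] ->
  (forall c : cyc_module K n.+1 2,
     in_ideal_smul (@irrelevant_ideal K n.+1) (cyc_diff G c)) ->
  [/\ (xarrow K G A B)@_0 = 0, (xarrow K G B C)@_0 = 0
    & (xarrow K G C A)@_0 = 0].
Proof.
move=> ct minG; pose t := @Cyc n.+1 3 [tuple A; B; C] ct.
have bd u : (cyc_boundary K G t u : {mpoly K[n.+1]})@_0 = 0.
  by apply: in_ideal_coef0; rewrite -diff_basis.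
have A0 : A != set0 by apply: (block_neq0 (s := 0) ct).
have B0 : B != set0 by apply: (block_neq0 (s := 1) ct).
have dAB : [disjoint A & B] := is_cyc_block_disjoint (r := 0) (s := 1) ct isT.
have neq (u v : cyc n.+1 2) : block u 0 != block v 0 -> (u == v) = false.
  by move=> nuv; apply: contraNF nuv => /eqP ->.
have b0 : block (cyc_merge t ord0) 0 = A :|: B by [].
have b1 : block (cyc_merge t (lift ord0 ord0)) 0 = A by [].
have bw : block (cyc_wrap t) 0 = B by [].
have nAB : A :|: B != A by apply: disjoint_setU_neq.
have nBA : A :|: B != B by rewrite setUC disjoint_setU_neq // disjoint_sym.
have nA_B : A != B.
  by apply: contraTneq dAB => ->; rewrite -setI_eq0 setIid.
have n01 := neq _ _ (etrans (congr2 (fun x y => x != y) b0 b1) nAB).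
have n0w := neq _ _ (etrans (congr2 (fun x y => x != y) b0 bw) nBA).
have n1w := neq _ _ (etrans (congr2 (fun x y => x != y) b1 bw) nA_B).
split.
- have := bd (cyc_merge t ord0); rewrite coef0_boundary3.
  by rewrite eqxx n01 n0w mulr1 !mulr0 !subr0.
- have := bd (cyc_merge t (lift ord0 ord0)); rewrite coef0_boundary3.
  rewrite eqxx [_ == cyc_merge t ord0]eq_sym n01 n1w mulr1 !mulr0 subr0 sub0r.
  by move/eqP; rewrite oppr_eq0 => /eqP.
- have := bd (cyc_wrap t); rewrite coef0_boundary3.
  rewrite eqxx ![cyc_wrap t == _]eq_sym n0w n1w mulr1 !mulr0 subr0 sub0r.
  by move/eqP; rewrite oppr_eq0 => /eqP.
Qed.

Lemma minimal_complete : (2 <= n)%N ->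
  (forall c : cyc_module K n.+1 2,
     in_ideal_smul (@irrelevant_ideal K n.+1) (cyc_diff G c)) ->
  strongly_complete G.
Proof.
move=> n2 minG i j nij; rewrite /Defs.arc lt0n; apply/negP=> /eqP Gij.
have xij : (xarrow K G [set i] [set j])@_0 = 1.
  rewrite xarrowE mcoeffX; suff -> : arr G [set i] [set j] = 0%MM by rewrite eqxx.
  apply/mnmP=> k; rewrite mnmE big_set1 mnm0E inE.
  by case: eqP => [->|]; rewrite ?Gij.
pose R := ~: [set i; j].
have R0 : R != set0.
  (* A third vertex is what makes the remaining block non-empty. *)
  by rewrite -card_gt0 -subn_gt0 cardsCs setCK cards2 nij card_ord subn0 subn_gt0.
have i0 : [set i] != set0 by apply/set0Pn; exists i; rewrite inE.
have j0 : [set j] != set0 by apply/set0Pn; exists j; rewrite inE.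
have dij : [disjoint [set i] & [set j]] by rewrite disjoints1 inE.
have diR : [disjoint [set i] & R] by rewrite disjoints1 !inE eqxx.
have djR : [disjoint [set j] & R] by rewrite disjoints1 !inE eqxx orbT.
have cov : [set i] :|: ([set j] :|: R) = setT by rewrite setUA setUCr.
suff : (xarrow K G [set i] [set j])@_0 = 0.
  by rewrite xij => /eqP; rewrite oner_eq0.
(* The cyclic order i, j, rest is rotated so that the block with [ord_max] comes last; the arrow
   from i to j is then the third, second or first coefficient. *)
have [ei|ni] := eqVneq i ord_max.
  have ct : is_cyc [:: [set j]; R; [set i]].
    apply: is_cyc3; rewrite ?inE ?ei // -?ei //.
    1,2: by rewrite disjoint_sym.
    by rewrite setUA setUC.
  by have [] := minimal_coef0 ct minG.
have [ej|nj] := eqVneq j ord_max.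
  have ct : is_cyc [:: R; [set i]; [set j]].
    apply: is_cyc3; rewrite ?inE ?ej // -?ej ?[[disjoint R & _]]disjoint_sym //.
    by rewrite setUC -setUA.
  by have [] := minimal_coef0 ct minG.
have ct : is_cyc [:: [set i]; [set j]; R].
  by apply: is_cyc3; rewrite // !inE negb_or eq_sym ni eq_sym nj.
by have [] := minimal_coef0 ct minG.
Qed.

End MinimalImpliesComplete.

Theorem corollary6p16 (K : fieldType) (n : nat) (G : digraph n) :
  (3 <= n)%N -> strongly_connected G ->
  (@free_resolution {mpoly K[n]} (lattice_ring K (lattice (laplacian G)))
     (fun k => cyc n k.+1) n.-1 (fun k => @cyc_diff K n G k) (@cyc_aug K n G)
   /\ @minimal {mpoly K[n]} (fun k => cyc n k.+1) (@irrelevant_ideal K n) n.-1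
        (fun k => @cyc_diff K n G k))
  <-> strongly_complete G.
Proof.
case: n G => [|n] G n3 connG; first by discriminate n3.
split=> [[_ minG] | complG].
  (* Index 1 is the differential from three blocks to two. *)
  by apply: (@minimal_complete K n G n3) => c; apply: (minG 1%N n3 c).
have [w w_fire] := exists_fire_decreasing connG.
split; last exact: complete_minimal.
split.
- exact: aug_surj.
- exact: (aug_exact w_fire).
- move=> k _ c; split=> [|[d <-]]; last exact: diff_diff.
  exact: (cycle_boundary w_fire).
move=> k eN x y exy.
(* The kernel in top degree is the image of a module whose basis partitions would have more blocks
   than there are vertices. *)
have [|d dxy] := @cycle_boundary K n G w w_fire k (x - y).
  by rewrite linearB /= exy subrr.
have d0 : d = 0.
  apply/ffunP=> u; exfalso.
  by have := is_cyc_size (blocksP u); rewrite size_tuple !ltnS eN ltnn.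
by apply/eqP; rewrite -subr_eq0 -dxy d0 diff0.
Qed.
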